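(* Let $r\geq 2$ be an integer and let $G$ be a connected graph with odd girth at least $g$, vertex set $V(G)=\{v_1,v_2,\ldots,v_n\}$, and degree sequence $\deg_G(v_1)\geq \deg_G(v_2)\geq\cdots\geq \deg_G(v_n)$. Suppose that $$r\leq \max\left\{\frac{g}{2},\ \frac{\deg_G(v_{r-1})+1}{4}\right\}$$ and that $\{v_1,\ldots,v_{r-1}\}$ is an independent set in $G$. If $\deg_G(v_{r-1})$ is an even integer or $\deg_G(v_{r-1})>\deg_G(v_r)$, then $$\chi(\mathrm{KG}(G,rK_2))=|E(G)|-\sum_{i=1}^{r-1}\deg_G(v_i).$$
   Context: All graphs are finite and simple. The odd girth of a graph is the length of its shortest odd cycle; the odd girth of a bipartite graph is defined to be infinite. $rK_2$ denotes the graph consisting of $r$ pairwise vertex-disjoint edges (a matching of size $r$). $\mathrm{KG}(G,rK_2)$ is the graph whose vertices are all subgraphs of $G$ isomorphic to $rK_2$ (i.e. all matchings of size $r$ in $G$), two of them being adjacent if they are edge-disjoint. $\chi$ denotes the chromatic number (equal to $0$ for the graph with no vertices). *)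

(* Defs.v *)
From mathcomp Require Import all_boot all_order all_algebra.

Set Implicit Arguments.
Unset Strict Implicit.
Unset Printing Implicit Defensive.

Record sgraph := SGraph {
  svertex :> finType;
  adj : rel svertex;
  adj_sym : symmetric adj;
  adj_irrefl : irreflexive adj }.

Definition deg (G : sgraph) (x : G) : nat := #|[set y : G | adj x y]|.

Definition edges (G : sgraph) : {set {set G}} :=
  [set [set p.1; p.2] | p : G * G & adj p.1 p.2].

Definition connected (G : sgraph) : Prop :=
  0 < #|G| /\ forall x y : G, connect (@adj G) x y.

Definition has_cycle (G : sgraph) (k : nat) : bool :=
  (2 < k) && [exists c : k.-tuple G, ucycleb (@adj G) c].

(* None stands for an infinite odd girth. As a cycle has no repeated vertex,  *)
(* its length is at most #|G|; iota is increasing, so ohead picks the minimum. *)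
Definition odd_girth (G : sgraph) : option nat :=
  ohead [seq k <- iota 0 #|G|.+1 | odd k && has_cycle G k].

Definition odd_girth_ge (G : sgraph) (g : nat) : bool :=
  if odd_girth G is Some k then g <= k else true.

Definition colorable (G : sgraph) (k : nat) : bool :=
  [exists f : {ffun G -> 'I_k},
    [forall x : G, forall y : G, adj x y ==> (f x != f y)]].

Lemma colorable_card (G : sgraph) : exists k, colorable G k.
Proof.
exists #|G|; apply/existsP; exists [ffun x => enum_rank x].
apply/forallP=> x; apply/forallP=> y; apply/implyP=> xy; rewrite !ffunE.
by apply/eqP=> /enum_rank_inj eq_xy; rewrite eq_xy adj_irrefl in xy.
Qed.

Definition chromatic_number (G : sgraph) : nat := ex_minn (colorable_card G).

(* A subgraph isomorphic to rK_2 has no isolated vertex, so it is encoded by  *)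
(* its edge set.                                                              *)
Definition is_rmatching (G : sgraph) (r : nat) (M : {set {set G}}) : bool :=
  [&& M \subset edges G, #|M| == r & trivIset M].

Definition rmatching (G : sgraph) (r : nat) : finType :=
  {M : {set {set G}} | is_rmatching r M}.

(* The test M != N only matters for r = 0, where set0 is disjoint from itself. *)
Definition kg_adj (G : sgraph) (r : nat) : rel (rmatching G r) :=
  fun M N => (M != N) && [disjoint val M & val N].

Lemma kg_adj_sym (G : sgraph) (r : nat) : symmetric (@kg_adj G r).
Proof. by move=> M N; rewrite /kg_adj eq_sym disjoint_sym. Qed.

Lemma kg_adj_irrefl (G : sgraph) (r : nat) : irreflexive (@kg_adj G r).
Proof. by move=> M; rewrite /kg_adj eqxx. Qed.

Definition KG (G : sgraph) (r : nat) : sgraph :=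
  SGraph (@kg_adj_sym G r) (@kg_adj_irrefl G r).

(* Main.v *)
Require Import Defs.
From mathcomp Require Import all_boot all_order all_algebra.
From mathcomp Require Import zify.

(** Write S for the set of the r - 1 vertices of largest degree and t for the
    sum of their degrees.

    Upper bound.  Each vertex lies on at most one edge of a matching, so an
    r-matching has an edge that avoids S ([KG_colorable]); colouring every
    r-matching by such an edge is proper.  As S is independent, exactly
    |E| - t edges avoid it ([independent_edges] gives the inequality used).

    Lower bound.  Order the edges linearly and give some of them a sign.  By
    Tucker's lemma ([tucker], which follows from Fan's parity count
    [fan_parity]), if every signing with more than s sign runs contains an
    r-matching of constant sign, then the chromatic number is at least
    |E| - s; this is [alternation_bound], in a form that also covers the
    version for strong alternation, where one may gain a unit.

    The order of the edges comes from trails.  A decomposition of a connected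
    graph into the least number of trails is either a single closed trail or
    consists of open trails whose ends are all distinct ([good_decomposition]).
    List the edges trail by trail.  In a signing whose signs alternate, two
    consecutive edges of a trail never have the same sign, so each vertex gets
    at most half of its edges, up to rounding, in either sign; only the base
    point of a closed trail may exceed this, by one and in one sign
    ([walk_vcount_sel], [all_edges_degree]).

    It remains to bound the size of a sign class R without r-matching.  Let
    2k be the largest even number that is at most the degree of the last
    vertex of S; the degree condition says that vertices outside S have degree
    at most 2k, so that t = (r - 1) 2k + sum_x (deg x - 2k)^+.
    Lemma [sparse_edges] gives |R| <= (r - 1) k + sum_x (deg_R x - k)^+.  It
    rests on Gallai's lemma: remove from R vertices covered by all maximum
    matchings, as long as there are any.  They play the part of a vertex
    cover; what is left has factor-critical components.  If the odd girth is
    at least 2r, these are too small to contain an odd cycle, hence have no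
    edges ([critical_odd_cycle]); if k >= 2r - 1, they have few edges
    ([critical_card]).

    Adding the bounds for the two signs shows that an alternating signing
    without an r-matching of constant sign has at most t edges when the trails
    are open ([bound_of_open_trails]).  For a closed trail the excess at the
    base point is absorbed by the strong form of the alternation bound
    ([bound_of_closed_trail]). *)

Set Implicit Arguments.
Unset Strict Implicit.
Unset Printing Implicit Defensive.

(** * Tucker's lemma for signed vectors *)

Lemma big_addb_involution (T : eqType) (h : T -> T) (F : T -> bool) (S : seq T) :
    uniq S ->
    (forall x, x \in S -> [/\ h x \in S, h (h x) = x, h x != x & F (h x) = F x]) ->
  \big[addb/false]_(x <- S) F x = false.
Proof.
have [n] := ubnP (size S); elim: n S => // n IHn [|x S] ltSn uS hS; first by rewrite big_nil.
have [hxS hhx hx_neq Fhx] := hS x (mem_head x S).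
have {}hxS : h x \in S by move: hxS; rewrite inE (negPf hx_neq).
have [xS uS'] : x \notin S /\ uniq S by apply/andP.
rewrite big_cons (perm_big _ (perm_to_rem hxS)) big_cons Fhx addbA addbb addFb.
apply: IHn => [||y]; rewrite ?rem_uniq //.
  by rewrite size_rem // -ltnS (leq_trans _ ltSn) // ltnS; case: (S) hxS.
rewrite mem_rem_uniq // !inE => /andP[y_hx yS].
have [|hyS hhy hy_neq Fhy] := hS y; first by rewrite inE yS orbT.
rewrite mem_rem_uniq // inE.
have -> : h y != h x by apply: contraNneq xS => eq_h; rewrite -hhx -eq_h hhy.
split=> //; move: hyS; rewrite inE => /predU1P[hyx|//].
by rewrite -hyx hhy eqxx in y_hx.
Qed.

(** A pair (i, b) stands for the signed number +i or -i; it serves both as a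
    signed coordinate and as a label. *)
Definition flip_sign (x : nat * bool) := (x.1, ~~ x.2).

Lemma flip_signK : involutive flip_sign. Proof. by case=> i b; rewrite /flip_sign /= negbK. Qed.

(** The absolute values increase strictly and the signs alternate, starting
    with b. *)
Fixpoint alternating_sorted (b : bool) (l : seq (nat * bool)) : bool :=
  if l is x :: l' then [&& x.2 == b, all (fun y => x.1 < y.1) l' & alternating_sorted (~~ b) l']
  else true.

(** The sign breaks ties only to make the order antisymmetric, so that sorting
    depends on the multiset of labels alone. *)
Definition lexle (x y : nat * bool) := (x.1 < y.1) || (x.1 == y.1) && (x.2 <= y.2).

Lemma lexle_total : total lexle.
Proof. by case=> i b [j c]; rewrite /lexle /=; case: b; case: c; lia. Qed.
Lemma lexle_trans : transitive lexle.
Proof. by case=> i b [j c] [k d]; rewrite /lexle /=; case: b; case: c; case: d; lia. Qed.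
Lemma lexle_anti : antisymmetric lexle.
Proof.
case=> i b [j c]; rewrite /lexle /= => H.
have -> : i = j by lia. by case: b c H => [] []//; lia.
Qed.

Definition alternating b l := alternating_sorted b (sort lexle l).

Lemma alternating_sorted_sorted b l : alternating_sorted b l -> sorted lexle l.
Proof.
elim: l b => //= x l IHl b /and3P[_ ltx /IHl]; case: l ltx {IHl} => //= y l /andP[ltxy _] ->.
by rewrite /lexle ltxy.
Qed.

Lemma alternatingP b l :
  reflect (exists2 l', perm_eq l' l & alternating_sorted b l') (alternating b l).
Proof.
apply: (iffP idP) => [alt_l | [l' ll' alt_l']].
  by exists (sort lexle l); rewrite // perm_sort.
have /(perm_sortP lexle_total lexle_trans lexle_anti) eq_l := ll'.
by rewrite /alternating -eq_l sorted_sort ?(alternating_sorted_sorted alt_l') //;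
  apply: lexle_trans.
Qed.

Lemma alternating_perm b l l' : perm_eq l l' -> alternating b l = alternating b l'.
Proof. by move/(perm_sortP lexle_total lexle_trans lexle_anti); rewrite /alternating => ->. Qed.

Lemma alternating_flip b l : alternating b (map flip_sign l) = alternating (~~ b) l.
Proof.
suff imp c l1 : alternating c (map flip_sign l1) -> alternating (~~ c) l1.
  apply/idP/idP => [/imp//|]; rewrite -{1}(mapK flip_signK l) => /imp; by rewrite negbK.
case/alternatingP=> l2 l12 alt2; apply/alternatingP; exists (map flip_sign l2).
  by rewrite -(mapK flip_signK l1) perm_map.
elim: l2 c alt2 {l12} => //= x l2 IHl c /and3P[/eqP<- ltx /IHl->].
by rewrite eqxx andbT all_map.
Qed.

Lemma alternating_uniq b l : alternating b l -> uniq (map fst l).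
Proof.
case/alternatingP=> l' ll'; rewrite -(perm_uniq (perm_map fst ll')).
elim: l' b {ll'} => //= x l' IHl b /and3P[_ ltx /IHl->]; rewrite andbT.
apply/mapP=> -[y yl' xy]; have := allP ltx y yl'; by rewrite xy ltnn.
Qed.

Definition del (T : Type) j (l : seq T) := take j l ++ drop j.+1 l.

Lemma del_perm (T : eqType) (x0 : T) j (l : seq T) : j < size l ->
  perm_eq (del j l) (rem (nth x0 l j) l).
Proof.
move=> ltj; rewrite -(perm_cons (nth x0 l j)) perm_sym.
apply: perm_trans (_ : perm_eq l _); first by rewrite perm_sym perm_to_rem ?mem_nth.
by rewrite -{1}(cat_take_drop j l) (drop_nth x0 ltj) perm_catC /= perm_cons perm_catC.
Qed.

Lemma perm_rem (T : eqType) (x : T) l l' : perm_eq l l' -> perm_eq (rem x l) (rem x l').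
Proof.
move=> ll'; have [xl|xl] := boolP (x \in l); last first.
  by rewrite !rem_id // -(perm_mem ll').
rewrite -(perm_cons x) -(permPl (perm_to_rem xl)) (perm_trans ll') //.
by rewrite perm_to_rem // -(perm_mem ll').
Qed.

(** A facet of a simplex arises by dropping one label.  An alternating label
    list of sign b or ~~ b, if not empty, has exactly one alternating facet of
    sign b: drop the last, respectively the first label.  A list that is not
    alternating has none or two: if dropping a label leaves an alternating list,
    a neighbour with the same sign can be dropped instead. *)
Lemma facet_parity_sorted b l :
    sorted lexle l -> (forall x, x \in l -> flip_sign x \notin l) ->
  \big[addb/false]_(x <- l) alternating_sorted b (rem x l) =
    alternating_sorted b l (+) alternating_sorted (~~ b) l.
Proof.
elim: l b => [|x l IHl] b; first by rewrite big_nil.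
move=> sl nopp; have sl' := path_sorted sl.
have minx := order_path_min lexle_trans sl.
have nopp' z : z \in l -> flip_sign z \notin l.
  by move=> zl; have := nopp z; rewrite !inE zl orbT negb_or => /(_ isT)/andP[].
rewrite big_cons [rem x _]/= eqxx.
have [ltx|] := boolP (all (fun y => x.1 < y.1) l).
  transitivity (alternating_sorted b l (+)
      ((x.2 == b) && \big[addb/false]_(z <- l) alternating_sorted (~~ b) (rem z l))).
    congr addb; rewrite big_distrr /=; apply: eq_big_seq => z zl.
    have xz : x != z by apply: contraTneq (allP ltx z zl) => ->; rewrite ltnn.
    rewrite /= (negPf xz) /=; congr (_ && _).
    by rewrite [X in X && _](_ : _ = true) //; apply/allP=> y /mem_rem /(allP ltx).
  rewrite (IHl _ sl' nopp').
  have alternating_consE c : alternating_sorted c (x :: l) =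
      (x.2 == c) && alternating_sorted (~~ c) l.
    by rewrite /=; congr (_ && _); rewrite [X in X && _](_ : _ = true).
  rewrite !alternating_consE negbK; case: (x.2) (b) => [] [] /=;
    by do 2 case: (alternating_sorted _ l).
case: l IHl sl nopp sl' minx nopp' => // y l _ _ nopp sl' minx _ nltx.
have xy : y = x.
  have := allP minx y (mem_head y l); have := nopp x (mem_head _ _).
  move: nltx; rewrite /= negb_and => nltx.
  have {nltx} : y.1 <= x.1.
    case/orP: nltx => [|/allPn[z zl]]; first by rewrite -leqNgt.
    rewrite -leqNgt; apply: leq_trans.
    have /= := order_path_min lexle_trans sl'; move/allP/(_ z zl); rewrite /lexle; lia.
  case: (x) (y) => i c [j d]; rewrite /lexle /flip_sign !inE !negb_or !xpair_eqE /=.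
  by case: c d => [] [] /=; rewrite ?andbT ?andbF => *; congr pair; lia.
(* The least label is repeated: only the two facets that drop a copy count. *)
rewrite xy in nopp sl' minx nltx *.
have notalts c d : alternating_sorted c (x :: x :: d) = false by rewrite /= ltnn andbF.
have rem2 : rem x [:: x, x & l] = x :: l by rewrite /= eqxx.
rewrite big_cons rem2 !notalts addbA addbb addFb.
rewrite big1_seq // => z /andP[_ zl]; have [xz|xz] := eqVneq x z.
  rewrite -xz in zl *; rewrite rem2 /=; case: allP => [/(_ x zl)|]; by rewrite ?ltnn ?andbF.
by rewrite [rem z _]/= (negPf xz) notalts.
Qed.

Lemma facet_parity b l : (forall x, x \in l -> flip_sign x \notin l) ->
  \big[addb/false]_(j < size l) alternating b (del j l) = alternating b l (+) alternating (~~ b) l.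
Proof.
move=> nopp; set x0 := (0, true).
rewrite (eq_bigr (fun j : 'I__ => alternating b (rem (nth x0 l j) l))); last first.
  by move=> j _; apply/alternating_perm/del_perm.
rewrite -(big_mkord xpredT (fun j => alternating b (rem (nth x0 l j) l))).
rewrite -(big_nth x0 xpredT (fun x => alternating b (rem x l))).
have ls : perm_eq (sort lexle l) l by rewrite perm_sort.
rewrite -(perm_big _ ls) /= -facet_parity_sorted.
- apply: eq_bigr => x _; rewrite /alternating; congr alternating_sorted.
  rewrite -[RHS](sorted_sort lexle_trans); last first.
    by apply: (subseq_sorted lexle_trans (rem_subseq _ _)); apply: sort_sorted lexle_total _.
  by apply/(perm_sortP lexle_total lexle_trans lexle_anti); rewrite perm_sym perm_rem.
- exact: sort_sorted lexle_total _.
by move=> x; rewrite !mem_sort; apply: nopp.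
Qed.

(** Full flags of signed vectors with support 0, ..., n - 1: the word w encodes
    the chain of the vectors given by its nonempty prefixes. *)
Definition signed_perms n : seq (seq (nat * bool)) :=
  [seq zip p (val q) | p <- permutations (iota 0 n), q <- enum {: n.-tuple bool}].

Lemma signed_perms_uniq n : uniq (signed_perms n).
Proof.
apply: allpairs_uniq; rewrite ?permutations_uniq ?enum_uniq //.
case=> p q [p' q'] /allpairsP[[p1 q1] /= [+ _ [-> ->]]] /allpairsP[[p2 q2] /= [+ _ [-> ->]]].
rewrite !mem_permutations => /perm_size; rewrite size_iota => s1.
move=> /perm_size; rewrite size_iota => s2 eqz.
have := congr1 (map fst) eqz; have := congr1 (map snd) eqz.
rewrite -!/(unzip1 _) -!/(unzip2 _) !unzip1_zip ?unzip2_zip ?size_tuple ?s1 ?s2 //.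
by move=> /val_inj -> ->.
Qed.

Lemma mem_signed_perms n w : (w \in signed_perms n) = perm_eq (unzip1 w) (iota 0 n).
Proof.
apply/allpairsP/idP => [[[p q] /= [+ _ ->]]|pw].
  by rewrite mem_permutations => pp; rewrite unzip1_zip // (perm_size pp) size_iota size_tuple.
have sw : size (unzip2 w) == n by rewrite size_map -(size_map fst) (perm_size pw) size_iota.
exists (unzip1 w, Tuple sw); split; rewrite ?mem_permutations ?mem_enum //=.
by rewrite zip_unzip.
Qed.

Section Tucker.

Variables (m N : nat) (lab : seq (nat * bool) -> nat * bool).

(** A partial flag: a prefix w of such a word denotes the signed vector whose
    nonzero coordinates are the entries of w. *)
Definition signed_word (w : seq (nat * bool)) :=
  uniq (unzip1 w) && all (fun i => i < m) (unzip1 w).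

(* The label depends on the signed vector only, not on the order of its entries. *)
Hypothesis lab_ext : forall w w', w =i w' -> lab w = lab w'.
Hypothesis lab_flip : forall w, signed_word w -> w != [::] ->
  lab (map flip_sign w) = flip_sign (lab w).
Hypothesis lab_mono : forall w w', signed_word (w ++ w') -> w != [::] ->
  lab (w ++ w') != flip_sign (lab w).
Hypothesis lab_bound : forall w, signed_word w -> w != [::] -> 0 < (lab w).1 <= N.

Definition labels (w : seq (nat * bool)) := [seq lab (take i.+1 w) | i <- iota 0 (size w)].

Lemma signed_perms_word n w : n <= m -> w \in signed_perms n -> signed_word w.
Proof.
move=> nm; rewrite mem_signed_perms => pw; rewrite /signed_word (perm_uniq pw) iota_uniq.
rewrite (perm_all _ pw); apply/allP=> i; rewrite mem_iota; lia.
Qed.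

Lemma signed_word_take k w : signed_word w -> signed_word (take k w).
Proof.
rewrite -{1}(cat_take_drop k w) /signed_word /unzip1 map_cat cat_uniq all_cat.
by case/andP=> /and3P[-> _ _] /andP[-> _].
Qed.

Lemma labels_flip w : signed_word w -> labels (map flip_sign w) = map flip_sign (labels w).
Proof.
move=> ww; rewrite /labels size_map -map_comp; apply/eq_in_map => i.
rewrite mem_iota /= => ltiw; rewrite -map_take lab_flip ?signed_word_take //.
by case: (w) ltiw.
Qed.

Lemma labels_no_flip w x : signed_word w -> x \in labels w -> flip_sign x \notin labels w.
Proof.
move=> ww /mapP[i]; rewrite mem_iota /= add0n => ltiw ->.
apply/mapP=> -[j]; rewrite mem_iota /= add0n => ltjw.
have key k l : k <= l -> l < size w -> lab (take l.+1 w) != flip_sign (lab (take k.+1 w)).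
  move=> lekl ltlw.
  have -> : take l.+1 w = take k.+1 w ++ drop k.+1 (take l.+1 w).
    by rewrite -{1}(cat_take_drop k.+1 (take l.+1 w)) take_takel.
  apply: lab_mono; last by case: (w) ltlw.
  rewrite -{1}(@take_takel _ k.+1 l.+1) // cat_take_drop; exact: signed_word_take.
case: (leqP i j) => [leij|/ltnW leji] eq_lab.
  by have := key i j leij ltjw; rewrite -eq_lab eqxx.
by have := key j i leji ltiw; rewrite -eq_lab flip_signK eqxx.
Qed.

Lemma map_del (T1 T2 : Type) (f : T1 -> T2) j l : del j (map f l) = map f (del j l).
Proof. by rewrite /del map_cat map_take map_drop. Qed.

(** The vector at position j of a flag can be replaced in exactly one other way
    between its neighbours; on words, this exchanges two entries. *)
Definition swap j (w : seq (nat * bool)) :=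
  if drop j w is x :: y :: w' then take j w ++ y :: x :: w' else w.

Lemma swapE j w x y w' : size w = j -> swap j (w ++ x :: y :: w') = w ++ y :: x :: w'.
Proof. by move=> <-; rewrite /swap drop_size_cat // take_size_cat. Qed.

Lemma labels_swap w x y w' :
  del (size w) (labels (w ++ x :: y :: w')) = del (size w) (labels (w ++ y :: x :: w')).
Proof.
rewrite /labels !map_del !size_cat /=; apply/eq_in_map=> i i_in; apply: lab_ext => z.
have i_neq : i != size w.
  move: i_in; rewrite /del mem_cat => /orP[].
    by rewrite take_iota mem_iota; lia.
  by rewrite drop_iota mem_iota; lia.
rewrite !take_cat; case: ltnP => // lewi; rewrite !mem_cat; congr (_ || _).
case eqk: (i.+1 - size w) => [|[|k]] /=; rewrite ?take0 //; first by lia.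
by rewrite !inE orbCA.
Qed.

Definition flip_last (w : seq (nat * bool)) :=
  if w is x :: w' then rcons (belast x w') (flip_sign (last x w')) else w.

Lemma flip_last_rcons w x : flip_last (rcons w x) = rcons w (flip_sign x).
Proof. by case: w => //= y w; rewrite belast_rcons last_rcons. Qed.

Lemma labels_rcons w x : del (size w) (labels (rcons w x)) = labels w.
Proof.
rewrite /labels map_del /del size_rcons take_iota drop_iota.
have -> : minn (size w) (size w).+1 = size w by lia.
have -> : (size w).+1 - (size w).+1 = 0 by lia.
rewrite cats0; apply/eq_in_map=> i; rewrite mem_iota add0n => /= ltiw.
by rewrite -cats1 takel_cat.
Qed.

(** The flags of a hemisphere, in which the last coordinate is positive. *)
Definition half_perms n := [seq w <- signed_perms n.+1 | (n, true) \in w].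

Lemma perm_signed_perms n :
  perm_eq (signed_perms n.+1) (half_perms n ++ map (map flip_sign) (half_perms n)).
Proof.
have keyn w b : w \in signed_perms n.+1 -> (n, b) \in w -> (n, ~~ b) \notin w.
  rewrite mem_signed_perms => /perm_uniq; rewrite iota_uniq => uw nbw; apply/negP => nbw'.
  move: uw; rewrite (perm_uniq (perm_map fst (perm_to_rem nbw))) /= => /andP[/negP[]].
  apply/mapP; exists (n, ~~ b) => //; move: nbw'.
    by rewrite (perm_mem (perm_to_rem nbw)) inE xpair_eqE; case: (b); rewrite andbF.
have keyN w : w \in signed_perms n.+1 -> exists b, (n, b) \in w.
  rewrite mem_signed_perms => /perm_mem/(_ n); rewrite mem_iota leq0n add0n ltnS leqnn.
  by case/mapP=> -[i b] ibw /= ->; exists b.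
have oppW w : (map flip_sign w \in signed_perms n.+1) = (w \in signed_perms n.+1).
  by rewrite !mem_signed_perms /unzip1 -map_comp.
have mopK : cancel (map flip_sign) (map flip_sign) by apply: mapK flip_signK.
apply: uniq_perm; first exact: signed_perms_uniq.
  rewrite cat_uniq (map_inj_uniq (can_inj mopK)) filter_uniq ?signed_perms_uniq //= andbT.
  apply/hasPn => _ /mapP[w + ->]; rewrite !mem_filter => /andP[nw wW].
  by rewrite oppW wW andbT -[X in X \in _]flip_signK (mem_map (can_inj flip_signK)) (keyn w true).
move=> w; rewrite mem_cat -{3}[w]mopK (mem_map (can_inj mopK)) !mem_filter oppW.
have [wW|] := boolP (w \in _); rewrite ?andbF // !andbT.
have [[]] := keyN w wW; first by move->.
by move=> nw; rewrite -[X in X \in map flip_sign w]flip_signK (mem_map (can_inj flip_signK)) nw orbT.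
Qed.

(** Fan's parity argument by induction on the dimension.  The sphere is the union
    of a hemisphere and its antipode, so the number of positive alternating
    flags of the sphere is the number of alternating flags, of either sign, of
    the hemisphere.  By [facet_parity] this is, modulo 2, the number of positive
    alternating facets of hemisphere flags.  Facets inside the hemisphere are
    counted twice and cancel; those on the boundary are the flags of the sphere
    of one dimension less. *)
Lemma fan_parity n : n <= m ->
  \big[addb/false]_(w <- signed_perms n) alternating true (labels w) = true.
Proof.
elim: n => [|n IHn] nm.
  have W0 : perm_eq (signed_perms 0) [:: [::]].
    apply: uniq_perm => //; first exact: signed_perms_uniq.
    move=> w; rewrite mem_signed_perms inE; case: w => //= x w.
    by apply/negP=> /perm_size.
  by rewrite (perm_big _ W0) /= big_seq1.
have Hword (w : seq (nat * bool)) : w \in half_perms n -> signed_word w.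
  by rewrite mem_filter => /andP[_]; apply: signed_perms_word.
have Hsize (w : seq (nat * bool)) : w \in half_perms n -> size w = n.+1.
  rewrite mem_filter mem_signed_perms => /andP[_ /perm_size].
  by rewrite size_map size_iota.
have Huniq : uniq (half_perms n) by rewrite filter_uniq ?signed_perms_uniq.
rewrite (perm_big _ (perm_signed_perms n)) /= big_cat /= big_map -big_split /=.
transitivity (\big[addb/false]_(w <- half_perms n)
               \big[addb/false]_(j < n.+1) alternating true (del j (labels w))).
  apply: eq_big_seq => w wH; rewrite labels_flip ?Hword // alternating_flip.
  rewrite -facet_parity => [|x]; last by apply: labels_no_flip; apply: Hword.
  by rewrite /labels size_map size_iota Hsize.
rewrite exchange_big big_ord_recr /= big1 ?addFb => [|j _]; last first.
  (* Facets that keep the top vector are shared by two flags of the hemisphere. *)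
  apply: (big_addb_involution (h := swap j)) => // w wH.
  have sw : @size (nat * bool) w = n.+1 := Hsize w wH.
  have [a [x [y [d [wE sa]]]]] : exists a x y d, w = a ++ x :: y :: d /\ size a = j.
    have ltj := ltn_ord j.
    case: (drop j w) (size_drop j w) (cat_take_drop j w) =>
      [|x [|y d]] /= sd wE; try (exfalso; lia).
    exists (take j w), x, y, d; split=> //.
    by rewrite size_take; case: ifP; lia.
  rewrite wE !swapE //.
  have pxy b c : perm_eq (a ++ b :: c :: d) (a ++ c :: b :: d).
    by rewrite perm_cat2l; apply: (permEl (perm_catCA [:: b] [:: c] d)).
  have wH' := wH; move: wH; rewrite wE /half_perms !mem_filter !mem_signed_perms.
  move=> /andP[nw pw]; split=> //.
  - by rewrite (perm_mem (pxy y x)) nw (perm_trans _ pw) // perm_map.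
  - rewrite eqseq_cat // eqxx /= eqseq_cons negb_and; apply/orP; left.
    move: (Hword w wH'); rewrite wE /signed_word /unzip1 map_cat cat_uniq /= => /andP[/and3P[_ _]].
    by rewrite inE negb_or => /andP[/andP[xy _] _] _; apply: contraNneq xy => ->.
  by rewrite -sa labels_swap.
rewrite -[RHS](IHn (ltnW nm)) (bigID (fun w => last (n, false) w == (n, true))) /=.
(* Dropping the top vector gives a boundary facet only when the entry dropped is
   the coordinate n; the other facets are shared by two flags as well. *)
rewrite addbC -big_filter (big_addb_involution (h := flip_last)) ?filter_uniq ?signed_perms_uniq //; last first.
  move=> w; rewrite mem_filter; case/lastP: w => [|w x].
    by case/andP=> _ /Hsize.
  rewrite last_rcons => /andP[xn wH]; rewrite !flip_last_rcons flip_signK.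
  have sw : size w = n by have := Hsize _ wH; rewrite size_rcons => -[].
  have [uw _] := andP (Hword _ wH).
  split=> //.
  - move: wH; rewrite !mem_filter last_rcons !mem_signed_perms !mem_rcons !inE.
    rewrite eq_sym (negPf xn) /= /unzip1 !map_rcons => /andP[nw ->]; rewrite nw orbT !andbT.
    move: uw; rewrite /unzip1 map_rcons rcons_uniq => /andP[+ _].
    by apply: contraNneq => /(congr1 fst) /= ->; apply: (map_f fst nw).
  - rewrite eqseq_rcons eqxx /=; by case: (x) => i [];
      rewrite xpair_eqE andbF.
  by rewrite -sw !labels_rcons.
rewrite addFb -big_filter.
rewrite (perm_big [seq rcons w (n, true) | w <- signed_perms n]) /=; last first.
  have injr : injective (fun w : seq (nat * bool) => rcons w (n, true)).
    by move=> w w' /rcons_inj[].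
  apply: uniq_perm; first by rewrite filter_uniq.
    by rewrite map_inj_uniq ?signed_perms_uniq.
  move=> w; rewrite !mem_filter; case/lastP: w => [|w x].
    rewrite xpair_eqE andbF /=; apply/esym/mapP => -[w _].
    by case: w.
  rewrite last_rcons; have [->|xn] := eqVneq x (n, true); last first.
    apply/esym/mapP => -[w' _ /eqP]; rewrite eqseq_rcons (negPf xn) andbF //.
  rewrite mem_rcons inE eqxx /= (mem_map injr) !mem_signed_perms /unzip1 map_rcons.
  by rewrite -[n.+1]addn1 iotaD /= -cats1 perm_cat2r.
rewrite big_map; apply: eq_big_seq => w; rewrite mem_signed_perms => /perm_size.
rewrite size_map size_iota => sw; congr alternating.
by rewrite -[in LHS]sw labels_rcons.
Qed.

(** Tucker's lemma *)
(** An odd number is not zero: some full flag has alternating labels, and these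
    have m distinct absolute values. *)
Lemma tucker : m <= N.
Proof.
have [w wW alt_w] : exists2 w, w \in signed_perms m & alternating true (labels w).
  apply/hasP/negbNE/hasPn => no_alt; have := fan_parity (leqnn m).
  by rewrite big1_seq // => w /andP[_ /no_alt/negPf].
have sw : size w = m.
  by move: wW; rewrite mem_signed_perms => /perm_size; rewrite size_map size_iota.
have ww := signed_perms_word (leqnn m) wW.
have := uniq_leq_size (alternating_uniq alt_w) (s2 := iota 1 N).
rewrite !size_map !size_iota sw; apply=> _ /mapP[_ /mapP[i + ->] ->].
rewrite !mem_iota add0n => /= ltiw; rewrite add1n ltnS; apply: lab_bound.
  exact: signed_word_take.
by case: (w) ltiw.
Qed.

End Tucker.

(** * Colourings and sign alternation *)

Fixpoint changes (b : bool) (l : seq bool) : nat :=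
  if l is x :: l' then (b != x) + changes x l' else 0.

(** The number of maximal blocks of equal signs, which is the length of a longest
    alternating subsequence. *)
Definition runs (l : seq bool) : nat :=
  if l is x :: l' then (changes x l').+1 else 0.

Lemma changes_subseq b a l : subseq a l -> changes b a <= changes b l.
Proof.
elim: l b a => [|y l IHl] b [|x a] //=; case: eqP => [->|_] sal.
  by rewrite leq_add2l IHl.
apply: leq_trans (_ : (b != y) + changes y (x :: a) <= _).
  by rewrite /= addnA leq_add2r; case: (b) (x) (y) => [] [] [].
by rewrite leq_add2l IHl.
Qed.

(** The equality case makes the pair of the number of runs and the first sign
    usable as a label in Tucker's lemma: enlarging a signed vector cannot change
    the first sign without creating a run. *)
Lemma runs_subseq a l : subseq a l -> a != [::] ->
  runs a <= runs l /\ (runs a = runs l -> head true a = head true l).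
Proof.
case: a => // x a; case: l => // y l /=; case: (eqVneq x y) => [->|neq_xy] sal _.
  by rewrite ltnS changes_subseq.
have := changes_subseq y sal; rewrite /= eq_sym neq_xy add1n => lt.
split=> [|eq_ch]; first exact: ltnW.
by case: eq_ch => eq_ch; rewrite eq_ch ltnn in lt.
Qed.

Lemma runs_negb l : runs (map negb l) = runs l.
Proof.
case: l => //= x l; congr _.+1; elim: l x => //= y l IHl x.
by rewrite IHl; case: (x) (y) => [] [].
Qed.

Lemma runs_gt0 l : (0 < runs l) = (l != [::]). Proof. by case: l. Qed.

Lemma subseq_pmap (S T : eqType) (f g : S -> option T) l :
    (forall x b, x \in l -> f x = Some b -> g x = Some b) ->
  subseq (pmap f l) (pmap g l).
Proof.
elim: l => //= x l IHl fg.
have {}IHl : subseq (pmap f l) (pmap g l).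
  by apply: IHl => y b yl; apply: fg; rewrite inE yl orbT.
case fx: (f x) => [b|] /=; first by rewrite (fg x b) ?mem_head //= eqxx.
by case: (g x) => //= b; apply: subseq_trans IHl (subseq_cons _ _).
Qed.

Section AlternationBound.

Variables (T : finType) (E : seq T) (F : {set {set T}}) (c : {set T} -> nat).
Variables (C s d : nat).
(* For d = 0 this is the bound by the alternation number; for d = 1, by the
   strong alternation number. *)
Hypothesis E_uniq : uniq E.
Hypothesis c_bound : forall A, A \in F -> c A <= C.
Hypothesis c_proper : forall A B, A \in F -> B \in F -> [disjoint A & B] -> c A != c B.
Hypothesis d_le_C : d <= C.
Hypothesis long_mono : forall f : T -> option bool, s < runs (pmap f E) ->
  exists A b, [/\ A \in F, d < c A & forall e, e \in A -> f e = Some b].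

(** The test for true comes first only to make the function total: signed words
    never contain both signs of a coordinate. *)
Definition sign_at (w : seq (nat * bool)) i : option bool :=
  if (i, true) \in w then Some true else if (i, false) \in w then Some false else None.

Definition sign w (e : T) := sign_at w (index e E).

Definition signed_part w b := [set e | sign w e == Some b].

Definition max_color w b := \max_(A in F | A \subset signed_part w b) c A.

(** Signed vectors with at most s runs are labelled by the number of runs; the
    others by the largest colour of a member of F of constant sign, shifted so
    that the two ranges of labels are 1, ..., s and s + 1, ..., s + C - d. *)
Definition label w : nat * bool :=
  let l := pmap (sign w) E in
  if runs l <= s then (runs l, head true l)
  else (s + maxn (max_color w true) (max_color w false) - d, max_color w false < max_color w true).

Lemma sign_atP m w i b : signed_word m w -> (sign_at w i == Some b) = ((i, b) \in w).
Proof.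
rewrite /sign_at /signed_word => /andP[uw _].
have excl : (i, true) \in w -> (i, false) \notin w.
  move=> it; apply/negP => if_.
  move: uw; rewrite (perm_uniq (perm_map fst (perm_to_rem it))) /= => /andP[/negP[]].
  apply/mapP; exists (i, false) => //; move: if_.
  by rewrite (perm_mem (perm_to_rem it)) inE xpair_eqE andbF.
case: b; case: ifP => [it|_]; rewrite ?eqxx //; last by case: ifP.
  by case: ifP.
by rewrite (negPf (excl it)).
Qed.

Lemma sign_ext w w' : w =i w' -> sign w =1 sign w'.
Proof. by move=> ww' e; rewrite /sign /sign_at !ww'. Qed.

Lemma label_ext w w' : w =i w' -> label w = label w'.
Proof.
move=> ww'; have ss := sign_ext ww'.
have partE b : signed_part w b = signed_part w' b by apply/setP=> e; rewrite !inE ss.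
have max_colorE b : max_color w b = max_color w' b by rewrite /max_color partE.
by rewrite /label !max_colorE (eq_pmap ss).
Qed.

Lemma sign_flip m w e : signed_word m w -> sign (map flip_sign w) e = omap negb (sign w e).
Proof.
move=> ww.
have ww' : signed_word m (map flip_sign w) by rewrite /signed_word /unzip1 -map_comp.
have memN i b : ((i, b) \in map flip_sign w) = ((i, ~~ b) \in w).
  rewrite -[(i, b)]flip_signK (mem_map (can_inj flip_signK)) //.
have Hb b : (sign (map flip_sign w) e == Some b) = (sign w e == Some (~~ b)).
  by rewrite !(sign_atP _ _ ww, sign_atP _ _ ww') memN.
have := Hb true; have := Hb false.
by case: (sign (map flip_sign w) e) (sign w e) => [[]|] [[]|].
Qed.

(** Members of F contained in parts of opposite sign are disjoint, hence have
    different colours; so the sign that carries the largest colour is well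
    defined and changes under the antipodal map. *)
Lemma max_color_neq m w : signed_word m w -> 0 < maxn (max_color w true) (max_color w false) ->
  max_color w true != max_color w false.
Proof.
move=> ww pos; apply/eqP => eq_top; move: pos; rewrite eq_top maxnn => pos.
have ex b : exists2 A, A \in F & (A \subset signed_part w b) /\ c A = max_color w b.
  have : 0 < max_color w b by case: (b); rewrite ?eq_top.
  rewrite /max_color; case: (pickP (fun A => (A \in F) && (A \subset signed_part w b))).
    move=> A0 PA0 _; case: (eq_bigmax_cond c (A := [pred A | (A \in F) && (A \subset signed_part w b)])).
      by apply/card_gt0P; exists A0.
    by move=> A /andP[AF sA] ->; exists A.
  by move=> P0; rewrite big_pred0.
have [A AF [sA cA]] := ex true; have [B BF [sB cB]] := ex false.
have : c A != c B.
  apply: c_proper => //; apply: disjointWl sA _; apply: disjointWr sB _.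
  by rewrite -setI_eq0; apply/eqP/setP=> e; rewrite !inE; case: (sign w e) => [[]|].
by rewrite cA cB eq_top eqxx.
Qed.

Lemma max_color_long w : s < runs (pmap (sign w) E) ->
  d < maxn (max_color w true) (max_color w false).
Proof.
move=> /long_mono[A [b [AF dA monoA]]].
apply: leq_trans dA _; apply: leq_trans (_ : max_color w b <= _); last first.
  by case: (b); rewrite leq_max leqnn ?orbT.
apply: leq_bigmax_cond; rewrite AF; apply/subsetP=> e /monoA eb.
by rewrite inE eb.
Qed.

Lemma sign_mono m w w' : signed_word m (w ++ w') ->
  forall e b, sign w e = Some b -> sign (w ++ w') e = Some b.
Proof.
move=> ww e b /eqP sb; apply/eqP; rewrite (sign_atP _ _ ww) mem_cat.
suff ww1 : signed_word m w by rewrite -(sign_atP _ _ ww1) sb.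
by move: ww; rewrite /signed_word /unzip1 map_cat cat_uniq all_cat => /andP[/and3P[-> _ _] /andP[-> _]].
Qed.

Lemma max_color_mono m w w' b : signed_word m (w ++ w') -> max_color w b <= max_color (w ++ w') b.
Proof.
move=> ww; apply/bigmax_leqP => A /andP[AF sA].
apply: leq_bigmax_cond; rewrite AF; apply: subset_trans sA _.
by apply/subsetP=> e; rewrite !inE => /eqP/(sign_mono ww)->.
Qed.

Lemma label_flip m w : signed_word m w -> pmap (sign w) E != [::] ->
  label (map flip_sign w) = flip_sign (label w).
Proof.
move=> ww nz.
have max_colorN b : max_color (map flip_sign w) b = max_color w (~~ b).
  rewrite /max_color (_ : signed_part _ b = signed_part w (~~ b)) //; apply/setP=> e.
  by rewrite !inE (sign_flip e ww); case: (sign w e) b => [[]|] [].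
have signN : pmap (sign (map flip_sign w)) E = map negb (pmap (sign w) E).
  elim: (E) => //= e E' IH; rewrite (sign_flip e ww); case: (sign w e) => //= b.
  by rewrite IH.
rewrite /label signN runs_negb; case: (leqP (runs (pmap (sign w) E))) => [_|long].
  by rewrite /flip_sign /=; case: (pmap _ _) nz.
have lt := max_color_long long; rewrite /flip_sign /= !max_colorN /= maxnC; congr pair.
by have := max_color_neq ww (leq_ltn_trans (leq0n d) lt); case: ltngtP.
Qed.

Lemma label_mono m w w' : signed_word m (w ++ w') -> pmap (sign w) E != [::] ->
  label (w ++ w') != flip_sign (label w).
Proof.
move=> ww nz; have ssub : subseq (pmap (sign w) E) (pmap (sign (w ++ w')) E).
  by apply: subseq_pmap => e b _; apply: sign_mono ww e b.
have [le_runs eq_runs] := runs_subseq ssub nz.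
have tm b := max_color_mono b ww.
rewrite /label /flip_sign; case: (leqP (runs (pmap (sign (w ++ w')) E))) => [short|long].
  rewrite (leq_trans le_runs short) /= xpair_eqE; apply/andP => -[/eqP/esym/eq_runs-> /eqP].
  by case: (head _ _).
have ltd := max_color_long long.
case: (leqP (runs (pmap (sign w) E))) => [short|long'] /=.
  by rewrite xpair_eqE; apply/andP=> -[/eqP eq_s _]; lia.
have ltd' := max_color_long long'.
rewrite xpair_eqE; apply/andP => -[/eqP eq_s /eqP eq_b].
have tn := max_color_neq ww (leq_ltn_trans (leq0n d) ltd).
have := tm true; have := tm false; move: eq_b tn.
case: ltnP; case: ltnP => //=; lia.
Qed.

Lemma sign_nonempty m w : m = size E -> signed_word m w -> w != [::] -> pmap (sign w) E != [::].
Proof.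
case: w => // -[i b] w mE ww _; have := ww; rewrite /signed_word /= => /and3P[_ ltim _].
have [e0 _] : exists e : T, true by case: (E) mE ltim => [->//|e]; exists e.
have eE : nth e0 E i \in E by rewrite mem_nth -?mE.
have se : sign ((i, b) :: w) (nth e0 E i) = Some b.
  by apply/eqP; rewrite (sign_atP _ _ ww) index_uniq -?mE ?mem_head.
rewrite -size_eq0 size_pmap -lt0n -has_count; apply/hasP; exists (nth e0 E i) => //.
by rewrite se.
Qed.

(** Tucker's lemma for [label]: the number of coordinates is at most the number
    of absolute values of labels. *)
Lemma alternation_bound : size E <= s + C - d.
Proof.
apply: (@tucker (size E) (s + C - d) label label_ext) => [w ww nz|w w' ww nz|w ww nz].
- exact: label_flip ww (sign_nonempty (erefl _) ww nz).
- apply: (label_mono ww); apply: sign_nonempty (erefl _) _ nz.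
  move: ww; rewrite /signed_word /unzip1 map_cat cat_uniq all_cat.
  by case/andP=> /and3P[-> _ _] /andP[-> _].
have := sign_nonempty (erefl _) ww nz; rewrite -runs_gt0 /label => rpos.
case: (leqP (runs (pmap (sign w) E))) => [short|/max_color_long lt] /=; first by lia.
have max_colorC b : max_color w b <= C by apply/bigmax_leqP=> A /andP[/c_bound].
have := max_colorC true; have := max_colorC false; lia.
Qed.

End AlternationBound.

(** * Matchings and Gallai's lemma *)

Lemma not_uniqP (T : eqType) (c : seq T) : ~~ uniq c ->
  exists x s1 s2 s3, c = s1 ++ x :: s2 ++ x :: s3.
Proof.
elim: c => //= x c IHc; have [xc _|xc /= /IHc[y [s1 [s2 [s3 ->]]]]] := boolP (x \in c).
  by case/splitPr: xc => s2 s3; exists x, [::], s2, s3.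
by exists y, (x :: s1), s2, s3.
Qed.

(** A repeated vertex splits a closed walk in two closed walks, one of which is
    odd and shorter. *)
Lemma odd_closed_walk_cycle (T : eqType) (e : rel T) (c : seq T) :
    cycle e c -> odd (size c) ->
  exists c', [/\ ucycle e c', odd (size c') & {subset c' <= c}].
Proof.
have [n] := ubnP (size c); elim: n c => // n IHn c ltn cyc_c odd_c.
have [uc|/not_uniqP[x [s1 [s2 [s3 cE]]]]] := boolP (uniq c).
  by exists c; split=> //; apply/andP.
have : cycle e (x :: s2 ++ x :: (s3 ++ s1)).
  by move: cyc_c; rewrite -(rot_cycle (size s1)) cE rot_size_cat /= -!catA /= -?catA.
rewrite /= rcons_cat cat_path /= => /and3P[p1 e1 p2].
have szc : size c = (size s2).+1 + (size (s3 ++ s1)).+1.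
  by rewrite cE !size_cat /= !size_cat /=; lia.
have [odd2|odd2] := boolP (odd (size (x :: s2))).
  have [||c' [uc' oc' sub]] := IHn (x :: s2) _ _ odd2.
  - by rewrite /=; lia.
  - by rewrite /= rcons_path p1 e1.
  exists c'; split=> // y /sub; rewrite cE mem_cat !inE mem_cat => /orP[->|->]; rewrite ?orbT //.
have [|||c' [uc' oc' sub]] := IHn (x :: (s3 ++ s1)).
- by rewrite /=; lia.
- by [].
- by move: odd_c; rewrite szc oddD; move: odd2 => /= /negPf ->.
exists c'; split=> // y /sub; rewrite cE !(mem_cat, inE) => /or3P[] ->; rewrite ?orbT //.
Qed.

Section Matchings.
Variable T : finType.
Implicit Types (H M N : {set {set T}}) (x y z : T) (e f : {set T}).

(** Graphs are given by their edge sets, as sets of pairs of vertices, so that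
    subgraphs on the same vertices are just subsets. *)
Definition matching H M := (M \subset H) && trivIset M.

(** The matching number. *)
Definition nu H := \max_(M | matching H M) #|M|.

Definition max_matching H M := matching H M && (#|M| == nu H).

Definition two_sets H := forall e, e \in H -> #|e| = 2.

Definition edge_degree H x := #|[set e in H | x \in e]|.

Lemma nu_max H M : matching H M -> #|M| <= nu H.
Proof. by move=> mM; rewrite /nu (leq_bigmax_cond _ mM). Qed.

Lemma disjoint_pair x y (A : {set T}) :
  [disjoint [set x; y] & A] = (x \notin A) && (y \notin A).
Proof. by rewrite -setI_eq0 setIUl setU_eq0 !setI_eq0 !disjoints1. Qed.

Lemma ex_max_matching H : exists M, max_matching H M.
Proof.
have m0 : matching H set0.
  by rewrite /matching sub0set; apply/trivIsetP => A B; rewrite inE.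
have : 0 < #|matching H| by apply/card_gt0P; exists set0.
case/(eq_bigmax_cond (fun M => #|M|)) => M mM eqM; exists M; rewrite /max_matching (mM : matching H M) /nu.
by rewrite -eqM eqxx.
Qed.

Lemma matching_sub H H' M : H' \subset H -> matching H' M -> matching H M.
Proof. by move=> sH /andP[sM tM]; rewrite /matching tM (subset_trans sM sH). Qed.

Lemma two_set_other H e x : two_sets H -> e \in H -> x \in e ->
  exists y, x != y /\ e = [set x; y].
Proof.
move=> H2 /H2/eqP/cards2P[u [v [uv ->]]]; rewrite !inE => /orP[] /eqP->; first by exists v.
by exists u; rewrite eq_sym setUC.
Qed.

Lemma handshake H : two_sets H -> \sum_x edge_degree H x = 2 * #|H|.
Proof.
move=> H2; rewrite mulnC -sum_nat_const -(eq_bigr _ H2).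
transitivity (\sum_x \sum_(e in H) if x \in e then 1 else 0).
  apply: eq_bigr => x _; rewrite -big_mkcondr /edge_degree -sum1_card.
  by apply: eq_bigl => e; rewrite inE.
rewrite exchange_big; apply: eq_bigr => e _ /=.
by rewrite -big_mkcond sum1_card.
Qed.

Lemma card_cover H M : two_sets H -> matching H M -> #|cover M| = 2 * #|M|.
Proof.
move=> H2 /andP[sM /eqP <-]; rewrite mulnC -sum_nat_const.
by apply: eq_bigr => e /(subsetP sM)/H2.
Qed.

Lemma matching_add H M e : two_sets H -> matching H M -> e \in H ->
  [disjoint e & cover M] -> matching H (e |: M) /\ #|e |: M| = #|M|.+1.
Proof.
move=> H2 /andP[sM tM] eH dis.
have disM f : f \in M -> [disjoint e & f].
  by move=> fM; apply: disjointWr dis; apply: bigcup_sup fM.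
have n0 : set0 \notin M by apply/negP => /(subsetP sM)/H2; rewrite cards0.
have [tM' eM] := trivIsetU1 disM tM n0.
by rewrite /matching subUset sub1set eH sM tM' cardsU1 eM.
Qed.

Lemma coverP M x : reflect (exists2 e, e \in M & x \in e) (x \in cover M).
Proof. by apply: (iffP bigcupP) => -[e]; exists e. Qed.

Lemma trivIset_eq M e f x : trivIset M -> e \in M -> f \in M -> x \in e -> x \in f -> e = f.
Proof.
move=> /trivIsetP tM eM fM xe xf; apply/eqP/negPn/negP=> /(tM e f eM fM).
by move/disjoint_setI0/setP/(_ x); rewrite !inE xe xf.
Qed.

Definition edge_rel H x y := [set x; y] \in H.

Lemma edge_rel_sym H : symmetric (edge_rel H).
Proof. by move=> x y; rewrite /edge_rel setUC. Qed.

(* The components of H are factor-critical: no vertex is covered by all maximum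
   matchings. *)
Section Critical.
Variable H : {set {set T}}.
Hypothesis H2 : two_sets H.
Hypothesis inessential : forall x, exists2 M, max_matching H M & x \notin cover M.

(** Gallai's relation: x and y are missed together by no maximum matching.  It
    contains adjacency, so its classes are unions of components of H. *)
Definition linked x y :=
  (x == y) || [forall M, max_matching H M ==> ((x \in cover M) || (y \in cover M))].

Lemma linkedP x y : reflect
  (x = y \/ forall M, max_matching H M -> x \notin cover M -> y \in cover M) (linked x y).
Proof.
apply: (iffP orP) => [[/eqP->|/forallP all_M]|[->|all_M]]; rewrite ?eqxx; auto.
  by right=> M mM /negPf xM; have := all_M M; rewrite mM xM.
right; apply/forallP=> M; apply/implyP=> mM; have [//|xM] := boolP (x \in cover M).
exact: all_M.
Qed.

Lemma linkedC x y : linked x y = linked y x.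
Proof. by rewrite /linked eq_sym; congr (_ || _); apply: eq_forallb => M; rewrite orbC. Qed.

Lemma edge_linked x y : [set x; y] \in H -> linked x y.
Proof.
move=> xyH; apply/linkedP; right=> M /andP[mM /eqP maxM] xM; apply/negPn/negP => yM.
have [|mM' cM'] := matching_add H2 mM xyH.
  by rewrite disjoint_pair xM yM.
by have := nu_max mM'; rewrite cM' maxM ltnn.
Qed.

(* Gallai's lemma *)
(** Gallai's lemma.  Suppose that M misses x and z, and let N be a maximum
    matching that misses y and shares as many edges with M as possible.  Then N
    covers x and z, so by counting M covers, besides y, a vertex a that N misses.
    Exchanging the edge of N at the M-partner b of a for the edge ab gives a
    matching that still misses y and shares one more edge with M. *)
Lemma linked_trans : transitive linked.
Proof.
move=> y x z /linkedP[->//|xy] /linkedP[<-|yz]; first by apply/linkedP; right.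
have [->|neq_xz] := eqVneq x z; first by rewrite /linked eqxx.
apply/linkedP; right=> M mM xM; apply/negPn/negP => zM.
have yM := xy M mM xM.
have [N0 mN0 yN0] := inessential y.
pose P N := max_matching H N && (y \notin cover N).
have PN0 : P N0 by rewrite /P mN0.
case: (arg_maxnP (fun N => #|M :&: N|) PN0) => N /andP[mN yN] maxN.
have xN : x \in cover N by apply/negPn/negP => /(xy N mN); apply/negP.
have zN := yz N mN yN.
have [mM1 /eqP cM] := andP mM; have [mN1 /eqP cN] := andP mN.
have [sM tM] := andP mM1; have [sN tN] := andP mN1.
have eqc : #|cover M| = #|cover N| by rewrite !(card_cover H2) ?cM ?cN.
have lt1 : 1 < #|cover M :\: cover N|.
  have <- : #|cover N :\: cover M| = #|cover M :\: cover N|.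
    by rewrite !cardsD setIC eqc.
  apply: leq_trans (_ : #|[set x; z]| <= _); first by rewrite cards2 neq_xz.
  by apply/subset_leq_card/subsetP=> u; rewrite !inE => /orP[] /eqP->; rewrite ?xM ?zM.
have [a] : exists a, a \in (cover M :\: cover N) :\ y.
  apply/card_gt0P; rewrite -ltnS; apply: leq_trans lt1 _.
  by rewrite [X in X <= _](cardsD1 y) -[X in _ <= X]add1n leq_add2r leq_b1.
rewrite !inE => /and3P[ay aN aM].
have [e eM ae] := coverP _ _ aM.
have [b [ab eab]] := two_set_other H2 (subsetP sM e eM) ae.
have be : b \in e by rewrite eab !inE eqxx orbT.
have bN : b \in cover N.
  apply/negPn/negP => bN; have [|mN' cN'] := matching_add H2 mN1 (subsetP sM e eM).
    by rewrite eab disjoint_pair aN bN.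
  by have := nu_max mN'; rewrite cN' cN ltnn.
have [f fN bf] := coverP _ _ bN.
have mNf : matching H (N :\ f).
  rewrite /matching (subset_trans (subsetDl _ _) sN) /=.
  by apply: trivIsetS tN; apply: subsetDl.
have af : a \notin f by apply: contra aN => af; apply/coverP; exists f.
have [|mN' cN'] := matching_add H2 mNf (subsetP sM e eM).
  rewrite eab disjoint_pair; apply/andP; split; apply/coverP=> -[h];
    rewrite in_setD1 => /andP[hf hN] h_in.
    by move/negP: aN; apply; apply/coverP; exists h.
  by rewrite (trivIset_eq tN hN fN h_in bf) eqxx in hf.
have PN' : P (e |: N :\ f).
  rewrite /P /max_matching mN' cN' -cN (cardsD1 f N) fN add1n eqxx /=.
  apply/coverP=> -[h]; rewrite in_setU1 in_setD1 => /orP[/eqP->|/andP[_ hN] yh].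
    rewrite eab !inE eq_sym (negPf ay) /= => /eqP yb; by rewrite yb bN in yN.
  by move/negP: yN; apply; apply/coverP; exists h.
have := maxN _ PN'; apply/negP; rewrite -ltnNge; apply/proper_card/properP; split.
  apply/subsetP=> h; rewrite !inE => /andP[hM hN]; rewrite hM hN /= andbT.
  have [hf|] := eqVneq h f; last by rewrite orbT.
  by rewrite (trivIset_eq tM hM eM (x := b)) ?eqxx // hf.
exists e; first by rewrite !inE eM eqxx.
rewrite inE eM /=; apply: contra aN => eN; by apply/coverP; exists e.
Qed.

Definition class x := [set y | linked x y].

Lemma class_uncovered x M y z : max_matching H M -> y \in class x -> z \in class x ->
  y \notin cover M -> z \notin cover M -> y = z.
Proof.
rewrite !inE linkedC => mM yx xz yM zM.
case/linkedP: (linked_trans yx xz) => // /(_ M mM yM); by rewrite (negPf zM).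
Qed.

Lemma class_card x M : max_matching H M -> #|class x| <= #|class x :&: cover M|.+1.
Proof.
move=> mM; rewrite -(cardsID (cover M)) -addn1 leq_add2l.
apply/card_le1_eqP => y z; rewrite !inE => /andP[yM xy] /andP[zM xz].
by apply: (@class_uncovered x M z y mM); rewrite ?inE.
Qed.

(** A maximum matching misses at most one vertex of a class. *)
Lemma class_nu x : #|class x| <= (2 * nu H).+1.
Proof.
have [M mM] := ex_max_matching H; apply: leq_trans (class_card x mM) _.
have [mM1 /eqP <-] := andP mM; rewrite ltnS -(card_cover H2 mM1).
exact/subset_leq_card/subsetIr.
Qed.

(** For a class C, a vertex of C has at most |C| - 1 neighbours, and a fixed
    maximum matching M covers at least that many vertices of C.  Summing over
    all vertices and exchanging the sums leaves at most 2 nu + 1 for each of the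
    2 nu vertices covered by M. *)
Lemma critical_card : #|H| <= nu H * (2 * nu H).+1.
Proof.
have [M mM] := ex_max_matching H; have [mM1 /eqP cM] := andP mM.
have deg_class x : edge_degree H x <= #|class x :&: cover M|.
  have lt0 : 0 < #|class x| by apply/card_gt0P; exists x; rewrite inE /linked eqxx.
  apply: leq_trans (_ : #|class x :\ x| <= _); last first.
    have := class_card x mM; rewrite (cardsD1 x (class x)) inE /linked eqxx; lia.
  apply: leq_trans (leq_imset_card (fun y => [set x; y]) _).
  apply/subset_leq_card/subsetP => e; rewrite inE => /andP[eH xe].
  have [y [xy eE]] := two_set_other H2 eH xe.
  apply/imsetP; exists y => //; rewrite !inE eq_sym xy edge_linked //.
  by rewrite -eE.
suff : 2 * #|H| <= 2 * (nu H * (2 * nu H).+1) by rewrite leq_pmul2l.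
rewrite -(handshake H2) mulnA -cM -(card_cover H2 mM1).
apply: (@leq_trans (\sum_x #|class x :&: cover M|)); first by apply: leq_sum => x _; apply: deg_class.
have -> : \sum_x #|class x :&: cover M| = \sum_(y in cover M) #|class y|.
  transitivity (\sum_x \sum_(y in cover M) if linked x y then 1 else 0).
    apply: eq_bigr => x _; rewrite -big_mkcondr -sum1_card; apply: eq_bigl => y.
    by rewrite !inE andbC.
  rewrite exchange_big; apply: eq_bigr => y _ /=; rewrite -sum1_card big_mkcond.
  by rewrite [RHS]big_mkcond; apply: eq_bigr => x _; rewrite inE linkedC; case: linked.
rewrite -sum_nat_const; apply: leq_sum => y _.
by rewrite (card_cover H2 mM1) cM class_nu.
Qed.

(** The bipartite double cover of H; a path from (x, false) to (x, true) is an odd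
    closed walk at x. *)
Definition cover_rel (p q : T * bool) := edge_rel H p.1 q.1 && (p.2 != q.2).

Lemma cover_rel_sym : connect_sym cover_rel.
Proof.
by apply: sym_connect_sym => p q; rewrite /cover_rel edge_rel_sym eq_sym.
Qed.

Lemma cover_rel_swap x b y c :
  connect cover_rel (x, b) (y, c) -> connect cover_rel (x, ~~ b) (y, ~~ c).
Proof.
case/connectP => p; elim: p x b => [|[z d] p IHp] x b /=.
  by move=> _ [-> ->].
case/andP=> e1 path_p /(IHp _ _ path_p); apply: connect_trans; apply: connect1.
by move: e1; rewrite /cover_rel /=; case: (b) (d) => [] [].
Qed.

Lemma cover_path_linked x b p : path cover_rel (x, b) p ->
  [/\ path (edge_rel H) x (map fst p), (last (x, b) p).1 = last x (map fst p),
      (last (x, b) p).2 = b (+) odd (size p) & {subset map fst p <= class x}].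
Proof.
elim: p x b => [|[y c] p IHp] x b /=; first by rewrite addbF.
case/andP=> /andP[/= exy bc] /IHp[-> -> -> sub]; split=> //; first by rewrite exy.
  by case: (b) (c) bc => [] [] //=; case: odd.
move=> z; rewrite !inE => /predU1P[->|/sub]; first exact: edge_linked.
by rewrite inE; apply: linked_trans; apply: edge_linked.
Qed.

(** If x0 lies on no odd closed walk, the component of an edge x0 y0 is
    bipartite with sides X false and X true.  A maximum matching that misses x0
    covers all its other vertices, hence X false has one vertex more than X true;
    one that misses y0 gives the opposite. *)
Lemma critical_odd_cycle : H != set0 ->
  exists c, [/\ ucycle (edge_rel H) c, odd (size c) & size c <= (2 * nu H).+1].
Proof.
case/set0Pn => e0 e0H; have /eqP/cards2P[x0 [y0 [xy0 e0E]]] := H2 e0H.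
have e_xy : edge_rel H x0 y0 by rewrite /edge_rel -e0E.
have [/connectP[p path_p last_p]|noodd] := boolP (connect cover_rel (x0, false) (x0, true)).
  have [pp lp op sub] := cover_path_linked path_p.
  rewrite -last_p /= in lp op.
  have cyc : cycle (edge_rel H) (map fst p).
    case/lastP: p {path_p last_p sub} pp lp op => // p [z c].
    rewrite map_rcons last_rcons /= => pp zx _; rewrite -zx in pp *.
    by rewrite -(rot_cycle (size (map fst p))) -cats1 rot_size_cat.
  have [|c [uc oc subc]] := odd_closed_walk_cycle cyc; first by rewrite size_map -op.
  exists c; split=> //; apply: leq_trans (class_nu x0); rewrite cardE.
  apply: uniq_leq_size; first by case/andP: uc.
  by move=> z /subc/sub; rewrite mem_enum.
pose X b := [set y | connect cover_rel (x0, false) (y, b)].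
have disX y : y \in X false -> y \notin X true.
  rewrite !inE => yf; apply: contra noodd => yt; apply: connect_trans yt _.
  by rewrite cover_rel_sym; apply: (cover_rel_swap (b := false) (c := false)).
have XE b : X b \subset class x0.
  apply/subsetP => y; rewrite inE => /connectP[p /cover_path_linked[_ lp _ sub] lastE].
  rewrite -lastE /= in lp; rewrite lp; have := mem_last x0 (map fst p).
  by rewrite inE => /predU1P[->|/sub//]; rewrite inE /linked eqxx.
have Xnext b x y : edge_rel H x y -> x \in X b -> y \in X (~~ b).
  rewrite !inE => exy cx; apply: connect_trans cx (connect1 _).
  by rewrite /cover_rel exy /=; case: (b).
have x0X : x0 \in X false by rewrite inE.
have y0X : y0 \in X true by apply: (Xnext false) x0X.
have balanced M : max_matching H M -> #|X false :&: cover M| = #|X true :&: cover M|.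
  move=> /andP[/andP[sM tM] _].
  have cardX b : #|X b :&: cover M| = \sum_(e in M) \sum_(x in e) (x \in X b).
    rewrite -big_trivIset //= -sum1_card -big_mkcondr.
    by apply: eq_bigl => x; rewrite inE andbC.
  rewrite !cardX; apply: eq_bigr => e eM; have eH := subsetP sM e eM.
  have /eqP/cards2P[u [v [uv eE]]] := H2 eH.
  have euv : edge_rel H u v by rewrite /edge_rel -eE.
  have evu : edge_rel H v u by rewrite edge_rel_sym.
  have uNv : u \notin [set v] by rewrite inE.
  rewrite eE !big_setU1 // !big_set1.
  have flip b z z' : edge_rel H z z' -> edge_rel H z' z -> (z \in X b) = (z' \in X (~~ b)).
    move=> ezz ez'z; apply/idP/idP => [|/(Xnext _ _ _ ez'z)]; first exact: Xnext.
    by rewrite negbK.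
  by rewrite (flip false u v) // (flip false v u) //= addnC.
have missed M x b : max_matching H M -> x \in class x0 -> x \notin cover M -> x \in X b ->
    #|X b| = #|X b :&: cover M|.+1 /\ #|X (~~ b)| = #|X (~~ b) :&: cover M|.
  move=> mM xC xM xb.
  have covX c y : y \in X c -> y != x -> y \in cover M.
    move=> yX yx; apply: contraNT yx => yM; apply/eqP.
    by apply: class_uncovered mM _ xC yM xM; apply: subsetP (XE c) y yX.
  rewrite (cardsD1 x (X b)) xb add1n; split.
    congr _.+1; apply: eq_card => y; rewrite !inE andbC.
    have [yX|] := boolP (y \in X b); last by rewrite inE => /negPf->.
    have [->|yx] := eqVneq y x; first by rewrite (negPf xM) andbF.
    by rewrite (covX b y yX yx).
  apply: eq_card => y; rewrite in_setI.
  have [yX|//] := boolP (y \in X (~~ b)); rewrite (covX _ _ yX) //.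
  apply: contraTneq yX => ->; case: (b) xb => [xt|]; last exact: disX.
  by apply: contraL xt => /disX.
have [M mM xM] := inessential x0; have [N mN yN] := inessential y0.
have x0C : x0 \in class x0 by rewrite inE /linked eqxx.
have y0C : y0 \in class x0 by rewrite inE edge_linked.
have [eq1 eq2] := missed M x0 false mM x0C xM x0X.
have [eq3 eq4] := missed N y0 true mN y0C yN y0X.
rewrite /= in eq2 eq4.
move: (balanced M mM) (balanced N mN) eq1 eq2 eq3 eq4; clear; lia.
Qed.

End Critical.

(** Removing a vertex covered by all maximum matchings lowers the matching number
    by one, so this stops. *)
Lemma strip_essential H : two_sets H -> exists A : {set T},
  let H' := [set e in H | [disjoint e & A]] in
  #|A| + nu H' <= nu H /\ forall x, exists2 M, max_matching H' M & x \notin cover M.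
Proof.
have [n] := ubnP (nu H); elim: n H => // n IHn H ltn H2.
have [/forallP noness|] := boolP [forall x, [exists M, max_matching H M && (x \notin cover M)]].
  exists set0; have -> /= : [set e in H | [disjoint e & set0]] = H.
    by apply/setP=> e; rewrite inE -setI_eq0 setI0 eqxx andbT.
  by rewrite cards0; split=> // x; have /existsP[M /andP[]] := noness x; exists M.
rewrite negb_forall => /existsP[x]; rewrite negb_exists => /forallP ess_x.
pose H1 := [set e in H | x \notin e].
have sH1 : H1 \subset H by apply/subsetP=> e; rewrite inE => /andP[].
have ltH1 : nu H1 < nu H.
  have [M /andP[mM /eqP <-]] := ex_max_matching H1.
  have mM' := matching_sub sH1 mM; rewrite ltn_neqAle nu_max // andbT.
  have := ess_x M; rewrite /max_matching mM' /= negb_and negbK => /orP[//|/coverP[e eM xe]].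
  by case/andP: mM => /subsetP/(_ e eM); rewrite inE xe andbF.
have [||A [leA noness]] := IHn H1; first exact: leq_trans ltH1 _.
  by move=> e /(subsetP sH1)/H2.
exists (x |: A) => /=.
have -> : [set e in H | [disjoint e & x |: A]] = [set e in H1 | [disjoint e & A]].
  apply/setP=> e; rewrite !inE -andbA; congr (_ && _).
  by rewrite -!setI_eq0 setIUr setU_eq0 setI_eq0 disjoint_sym disjoints1.
split=> //; apply: leq_trans ltH1; apply: leq_trans (leq_add (_ : _ <= #|A|.+1) (leqnn _)) _.
  by rewrite cardsU1; case: (_ \in _).
by rewrite addSn ltnS.
Qed.

(** With A from [strip_essential], the edges that meet A number at most the sum of
    the degrees over A, hence at most |A| k plus the total excess over k; the
    other edges number at most (n - |A|) k. *)
Lemma sparse_edges H n k : two_sets H -> nu H <= n ->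
    ((2 * n).+1 <= k \/
      forall c, ucycle (edge_rel H) c -> odd (size c) -> (2 * n).+1 < size c) ->
  #|H| <= n * k + \sum_x (edge_degree H x - k).
Proof.
move=> H2 nun cond; have [A [/= leA noness]] := strip_essential H2.
set H' := [set e in H | _] in leA noness.
have sH' : H' \subset H by apply/subsetP=> e; rewrite inE => /andP[].
have H2' : two_sets H' by move=> e /(subsetP sH')/H2.
have leH' : #|H'| <= nu H' * k.
  case: cond => [lek|long].
    apply: leq_trans (critical_card H2' noness) _; rewrite leq_mul2l; apply/orP; right.
    by apply: leq_trans lek; lia.
  have [->|/(critical_odd_cycle H2' noness)[c [uc oc sc]]] := eqVneq H' set0.
    by rewrite cards0.
  have /long/(_ oc) : ucycle (edge_rel H) c.
    case/andP: uc => cyc uc; apply/andP; split=> //.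
    by apply: sub_cycle cyc => x y; apply: (subsetP sH').
  lia.
have leD : #|H :\: H'| <= \sum_(x in A) edge_degree H x.
  apply: leq_trans (_ : #|\bigcup_(x in A) [set e in H | x \in e]| <= _).
    apply/subset_leq_card/subsetP => e; rewrite !inE => /andP[+ eH]; rewrite eH /=.
    rewrite -setI_eq0 => /set0Pn[x]; rewrite inE => /andP[xe xA].
    by apply/bigcupP; exists x; rewrite // inE eH.
  elim/big_rec2: _ => [|x a B _ leBa]; first by rewrite cards0.
  by apply: leq_trans (leq_card_setU _ _) _; rewrite leq_add2l.
have leS : \sum_(x in A) edge_degree H x <= #|A| * k + \sum_x (edge_degree H x - k).
  apply: leq_trans (_ : \sum_(x in A) (k + (edge_degree H x - k)) <= _).
    by apply: leq_sum => x _; lia.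
  rewrite big_split /= sum_nat_const leq_add2l [leqRHS](bigID (mem A)) /=.
  exact: leq_addr.
have := cardsID H' H; have /setIidPr-> := sH' => <-.
apply: leq_trans (leq_add leH' leD) _; apply: leq_trans (leq_add (leqnn _) leS) _.
rewrite addnA leq_add2r -mulnDl leq_mul2r; apply/orP; right; lia.
Qed.

End Matchings.

(** * Decomposition of a connected graph into trails *)

Section Trails.
Variable T : finType.
Implicit Types (H : {set {set T}}) (x y z : T) (p q : seq T) (e : {set T}).
Implicit Types (t : T * seq T) (ts : seq (T * seq T)).

Fixpoint walk_edges x p : seq {set T} :=
  if p is y :: p' then [set x; y] :: walk_edges y p' else [::].

(** A trail is a pair of its first vertex and the list of the following ones.
    The members of a [decomposition] traverse no edge twice, because the edges
    listed enumerate the edge set. *)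
Definition trail_edges t := walk_edges t.1 t.2.
Definition trail_end t := last t.1 t.2.
Definition all_edges ts := flatten (map trail_edges ts).
Definition trail_ends ts := flatten [seq [:: t.1; trail_end t] | t <- ts].

Lemma walk_edges_cat x p q :
  walk_edges x (p ++ q) = walk_edges x p ++ walk_edges (last x p) q.
Proof. by elim: p x => //= y p IHp x; rewrite IHp. Qed.

Lemma walk_edges_vertex x p e z : e \in walk_edges x p -> z \in e -> z \in x :: p.
Proof.
elim: p x => //= y p IHp x; rewrite inE => /predU1P[->|/IHp{}IHp /IHp].
  by rewrite !inE => /orP[] ->; rewrite ?orbT.
by rewrite [z \in x :: _]inE orbC => ->.
Qed.

Lemma trail_rev t : exists t',
  [/\ perm_eq (trail_edges t') (trail_edges t), t'.1 = trail_end t & trail_end t' = t.1].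
Proof.
case: t => x p; elim: p x => [|y p IHp] x; first by exists (x, [::]).
have [[z q] []] := IHp y; rewrite /trail_edges /trail_end /= => eq_zq zE lastq.
exists (z, rcons q x); split; rewrite /= ?last_rcons // -cats1 walk_edges_cat lastq /=.
by rewrite (setUC [set y]) perm_catC /= perm_cons.
Qed.

Lemma trail_rotate x p z : last x p = x -> z \in x :: p ->
  exists2 q, last z q = z & perm_eq (walk_edges z q) (walk_edges x p).
Proof.
move=> closed_p z_in; case: (splitPl z_in) closed_p => p1 p2 lastp1.
rewrite last_cat lastp1 => closed_p; exists (p2 ++ p1).
  by rewrite last_cat closed_p.
by rewrite !walk_edges_cat closed_p lastp1 perm_catC.
Qed.

(** A closed trail can be inserted into any trail that shares a vertex with it. *)
Lemma trail_splice x p y q z : last x p = x -> z \in x :: p -> z \in y :: q ->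
  exists q', perm_eq (walk_edges y q') (walk_edges x p ++ walk_edges y q).
Proof.
move=> closed_p z_p z_q; have [p' lastp' eqp'] := trail_rotate closed_p z_p.
case: (splitPl z_q) => q1 q2 lastq1; exists (q1 ++ p' ++ q2).
rewrite !walk_edges_cat lastq1 lastp' perm_catCA perm_cat2r eqp' //.
Qed.

Lemma all_edges_perm ts ts' : perm_eq ts ts' -> perm_eq (all_edges ts) (all_edges ts').
Proof. by move=> eq_ts; rewrite /all_edges perm_flatten // perm_map. Qed.

(** Two trails with a common end can be joined, after reversing one of them if
    necessary. *)
Lemma trail_merge t t' : [|| t.1 == t'.1, t.1 == trail_end t', trail_end t == t'.1
      | trail_end t == trail_end t'] ->
  exists t'', perm_eq (trail_edges t'') (trail_edges t ++ trail_edges t').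
Proof.
have merge u u' : trail_end u = u'.1 ->
    perm_eq (trail_edges (u.1, u.2 ++ u'.2)) (trail_edges u ++ trail_edges u').
  by move=> eq_u; rewrite /trail_edges /= walk_edges_cat -/(trail_end u) eq_u.
have [u [eu u1 u2]] := trail_rev t; have [u' [eu' u'1 u'2]] := trail_rev t'.
case/or4P => /eqP eq_tt'.
- exists (u.1, u.2 ++ t'.2); rewrite -(permPr (perm_cat eu (perm_refl _))); apply: merge.
  by rewrite u2.
- exists (t'.1, t'.2 ++ t.2); rewrite perm_sym perm_catC perm_sym; apply: merge.
  by rewrite eq_tt'.
- by exists (t.1, t.2 ++ t'.2); apply: merge.
exists (t.1, t.2 ++ u'.2); rewrite -(permPr (perm_cat (perm_refl _) eu')); apply: merge.
by rewrite u'1.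
Qed.

Lemma trail_merge_mem ts : ~~ uniq (trail_ends ts) ->
  (exists2 t, t \in ts & trail_end t = t.1) \/
  exists2 ts', size ts' < size ts & perm_eq (all_edges ts') (all_edges ts).
Proof.
elim: ts => //= t ts IHts.
have [closed_t|open_t] := eqVneq (trail_end t) t.1.
  by left; exists t; rewrite ?mem_head.
have mem_ends x : x \in trail_ends ts -> exists2 t', t' \in ts & (x == t'.1) || (x == trail_end t').
  by case/flattenP=> _ /mapP[t' t'ts ->]; rewrite !inE; exists t'.
have [shared|] := boolP ((t.1 \in trail_ends ts) || (trail_end t \in trail_ends ts)).
  have [t' t'ts tt'] : exists2 t', t' \in ts & [|| t.1 == t'.1, t.1 == trail_end t',
      trail_end t == t'.1 | trail_end t == trail_end t'].
    by case/orP: shared => /mem_ends[t' t'ts /orP[] tt']; exists t'; rewrite ?tt' ?orbT.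
  have [t'' et''] := trail_merge tt'; right; exists (t'' :: rem t' ts).
    by rewrite /= size_rem // ltnS; case: (ts) t'ts.
  have /(perm_cat (perm_refl (trail_edges t))) := all_edges_perm (perm_to_rem t'ts).
  rewrite /all_edges /= catA => eq_all.
  by rewrite perm_sym (perm_trans eq_all) // perm_cat2r perm_sym.
rewrite negb_or => /andP[h1 h2]; rewrite /trail_ends /= inE negb_or eq_sym open_t h1 h2 /=.
move=> /IHts[[t' t'ts closed_t']|[ts' lt_ts' eq_ts']].
  by left; exists t'; rewrite // inE t'ts orbT.
by right; exists (t :: ts'); rewrite ?ltnS // /all_edges /= perm_cat2l.
Qed.

Definition decomposition H ts := perm_eq (all_edges ts) (enum H).

Lemma ex_decomposition H : two_sets H -> exists ts, decomposition H ts.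
Proof.
move=> H2; rewrite /decomposition; have : {subset enum H <= H} by move=> e; rewrite mem_enum.
elim: (enum H) => [|e l IHl] sub; first by exists [::].
have [|ts eq_ts] := IHl; first by move=> f fl; apply: sub; rewrite inE fl orbT.
have /eqP/cards2P[x [y [xy ->]]] := H2 e (sub e (mem_head _ _)).
by exists ((x, [:: y]) :: ts); rewrite /all_edges /= perm_cons.
Qed.

(** If an end occurs twice, two trails can be joined or some trail is closed.  In
    the latter case a second trail meets the closed one, or else, by connectedness,
    the vertices of the closed trail are all vertices; so it can be spliced. *)
Lemma decomposition_reduce H ts : (forall x y, connect (edge_rel H) x y) ->
    decomposition H ts ->
  [\/ uniq (trail_ends ts), exists2 t, ts = [:: t] & trail_end t = t.1
     | exists2 ts', size ts' < size ts & decomposition H ts'].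
Proof.
move=> conn dec; have [|/trail_merge_mem[]] := boolP (uniq (trail_ends ts)).
- by constructor 1.
- case=> -[x p] tts /= closed_p; rewrite /trail_end /= in closed_p.
  have eq_ts := perm_to_rem tts; set rest := rem _ _ in eq_ts.
  have eq_all := all_edges_perm eq_ts.
  case E: rest => [|[y0 q0] rest'].
    constructor 2; exists (x, p) => //.
    by apply: perm_small_eq; rewrite // -E.
  constructor 3.
  have [/hasP[[y q] yq_rest /hasP[z z_q z_p]]|disj] :=
      boolP (has (fun t => has [in x :: p] (t.1 :: t.2)) rest).
    have [q' eq_q'] := trail_splice closed_p z_p z_q.
    exists ((y, q') :: rem (y, q) rest).
      by rewrite (perm_size eq_ts) /= size_rem // ltnS prednK //; case: (rest) yq_rest.
    rewrite /decomposition perm_sym (perm_trans _ (perm_trans eq_all _)) //; first by rewrite perm_sym.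
    have /(perm_cat (perm_refl (walk_edges x p))) := all_edges_perm (perm_to_rem yq_rest).
    rewrite /all_edges /= catA => eq2.
    by rewrite (perm_trans eq2) // perm_cat2r perm_sym.
  have closedV : closed (edge_rel H) [in x :: p].
    apply: intro_closed; first by apply: sym_connect_sym; apply: edge_rel_sym.
    move=> u v uvH u_p.
    have : [set u; v] \in all_edges ts by rewrite (perm_mem dec) mem_enum.
    rewrite (perm_mem eq_all) mem_cat => /orP[uv_p|/flattenP[_ /mapP[[y q] yq ->] uv_q]].
      by apply: walk_edges_vertex uv_p _; rewrite !inE eqxx orbT.
    case/negP: disj; apply/hasP; exists (y, q) => //; apply/hasP; exists u => //.
    by apply: walk_edges_vertex uv_q _; rewrite !inE eqxx.
  have y0_p : y0 \in x :: p by rewrite -(closed_connect closedV (conn x y0)) mem_head.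
  case/negP: disj; apply/hasP; exists (y0, q0); first by rewrite E mem_head.
  by apply/hasP; exists y0; rewrite ?mem_head.
by case=> ts' lt_ts' eq_ts'; constructor 3; exists ts'; rewrite // /decomposition (permPl eq_ts').
Qed.

Lemma good_decomposition H : two_sets H -> (forall x y, connect (edge_rel H) x y) ->
  exists2 ts, decomposition H ts &
    uniq (trail_ends ts) \/ exists2 t, ts = [:: t] & trail_end t = t.1.
Proof.
move=> H2 conn; have [ts] := ex_decomposition H2.
have [n] := ubnP (size ts); elim: n ts => // n IHn ts ltn dec.
case: (decomposition_reduce conn dec) => [u|c|[ts' lt_ts' dec']].
- by exists ts; auto.
- by exists ts; auto.
by apply: IHn dec'; apply: leq_trans lt_ts' _.
Qed.

(* alternating selections *)
Section Selection.
Variables (f : {set T} -> option bool) (b : bool).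

Definition vcount z (l : seq {set T}) := count (fun e => z \in e) l.
Definition vcount_sel z (l : seq {set T}) := count (fun e => (z \in e) && (f e == Some b)) l.

Definition nonconsecutive (l : seq {set T}) :=
  sorted (fun e e' => ~~ ((f e == Some b) && (f e' == Some b))) l.

Lemma mem_edge z u v : #|[set u; v]| = 2 -> (z \in [set u; v] : nat) = (u == z) + (v == z).
Proof.
rewrite cards2 !inE ![z == _]eq_sym.
by case: (u =P z) => [->|_]; case: (v =P z) => [->|_]; rewrite ?eqxx.
Qed.

(** Each passage of the trail through z uses two consecutive edges, at most one of
    which is selected.  The correction terms account for the ends of the trail, where
    a selected edge is unmatched; tracking whether the first and last edges are
    selected is what makes the induction go through, and is used for closed trails. *)
Lemma walk_vcount_sel z x y p :
    let l := walk_edges x (y :: p) in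
    let first_sel := f [set x; y] == Some b in
    let last_sel := f (last set0 l) == Some b in
    {in l, forall e : {set T}, #|e| = 2} -> nonconsecutive l ->
  2 * vcount_sel z l + (~~ first_sel && (x == z)) + (~~ last_sel && (last y p == z)) <=
  vcount z l + (first_sel && (x == z)) + (last_sel && (last y p == z)).
Proof.
elim: p x y => [|u p IHp] x y l first_sel last_sel l2 nc.
  have := mem_edge z (l2 _ (mem_head _ _)).
  rewrite /vcount_sel /vcount /last_sel /l /= -/first_sel.
  by case: first_sel; rewrite ?andbT ?andbF /=; lia.
have l2' : {in walk_edges y (u :: p), forall e : {set T}, #|e| = 2}.
  by move=> e el; apply: l2; rewrite inE el orbT.
have := IHp y u l2' (path_sorted nc); have := mem_edge z (l2 _ (mem_head _ _)).
have -> : vcount_sel z l = (z \in [set x; y]) && first_sel + vcount_sel z (walk_edges y (u :: p)) by [].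
have -> : vcount z l = (z \in [set x; y]) + vcount z (walk_edges y (u :: p)) by [].
rewrite -[last y (u :: p)]/(last u p) -[f (last set0 _) == _]/last_sel.
have : ~~ (first_sel && (f [set y; u] == Some b)) by case/andP: nc.
case: first_sel; case: (f [set y; u] == Some b) => //= _;
  rewrite ?andbT ?andbF /=; clear; lia.
Qed.

End Selection.

End Trails.

(** * Alternating signings of the edges *)

Definition occurrences (b : bool) (l : seq bool) : nat := count (pred1 b) l.

Definition neqb (a b : bool) := a != b.

(** Alternating signs are equally frequent, up to the sign in excess at the two
    ends. *)
Lemma alternating_count b a l : path neqb a l ->
  size (a :: l) + (a == b) + (last a l == b) = (2 * occurrences b (a :: l)).+1.
Proof.
elim: l a => [|x l IHl] a; first by rewrite /occurrences /=; case: (a) (b) => [] [].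
case/andP=> ax /IHl; rewrite /occurrences /=; case: (a) (b) (x) ax => [] [] [] //= _; lia.
Qed.

Lemma last_pmap (S T : Type) (f : S -> option T) x0 a l v :
  f (last x0 l) = Some v -> 0 < size l -> last a (pmap f l) = v.
Proof. by case/lastP: l => // l x; rewrite last_rcons -cats1 pmap_cat last_cat /= => ->. Qed.

Lemma alternating_selection_from (T : eqType) (g : T -> option bool) (l : seq T) b0 :
  uniq l ->
  exists f : T -> option bool,
    [/\ forall x v, f x = Some v -> g x = Some v, path neqb b0 (pmap f l)
      & size (pmap f l) = changes b0 (pmap g l)].
Proof.
elim: l b0 => [|x l IHl] b0; first by exists (fun=> None).
case/andP=> xl ul.
have upd f (v : option bool) : pmap (fun y => if y == x then v else f y) l = pmap f l.
  by apply: eq_in_pmap => y yl; case: eqP yl xl => // -> ->.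
have drop_x : changes b0 (pmap g (x :: l)) = changes b0 (pmap g l) ->
    exists f : T -> option bool,
    [/\ forall y v, f y = Some v -> g y = Some v, path neqb b0 (pmap f (x :: l))
      & size (pmap f (x :: l)) = changes b0 (pmap g (x :: l))].
  move=> ->; have [f [fg alt_f size_f]] := IHl b0 ul.
  exists (fun y => if y == x then None else f y); rewrite /= eqxx /= upd; split=> // y v.
  by case: eqP => // _ /fg.
case gx: (g x) => [v|]; last by apply: drop_x; rewrite /= gx.
have [vb|vb] := eqVneq b0 v; first by apply: drop_x; rewrite /= gx /= vb eqxx.
have [f [fg alt_f size_f]] := IHl v ul.
exists (fun y => if y == x then Some v else f y); rewrite /= eqxx gx /= upd /neqb vb size_f.
split=> // y u; by case: eqP => [-> <-|_ /fg].
Qed.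

(** Keeping one entry of each run gives an alternating signing. *)
Lemma alternating_selection (T : eqType) (g : T -> option bool) (l : seq T) : uniq l ->
  exists f : T -> option bool,
    [/\ forall x v, f x = Some v -> g x = Some v, sorted neqb (pmap f l)
      & size (pmap f l) = runs (pmap g l)].
Proof.
move=> ul; have [f [fg alt_f size_f]] :=
  alternating_selection_from g (~~ head true (pmap g l)) ul.
exists f; split=> //; first exact: path_sorted alt_f.
by rewrite size_f; case: (pmap g l) => //= x s; case: x.
Qed.

Lemma alternating_nonconsecutive (T : finType) (f : {set T} -> option bool) b l :
  sorted neqb (pmap f l) -> nonconsecutive f b l.
Proof.
elim: l => // e [|e' l] //= IHl.
have tail : sorted neqb (oapp (cons^~ (pmap f (e' :: l))) (pmap f (e' :: l)) (f e)) ->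
    sorted neqb (pmap f (e' :: l)).
  by case: (f e) => //= a /path_sorted.
move=> al; rewrite /nonconsecutive /= (IHl (tail al)) andbT.
apply/andP => -[/eqP fe /eqP fe']; move: al; rewrite fe /= fe' /= /neqb eqxx.
by [].
Qed.

(* The number n is r - 1; the condition on k is what makes the sign classes
   without r-matching sparse. *)
Section LowerBound.
Variables (T : finType) (H : {set {set T}}) (n k : nat).
Hypothesis H2 : two_sets H.
Hypothesis conn : forall x y, connect (edge_rel H) x y.
Hypothesis cover_cond : (2 * n).+1 <= k \/
  forall c, ucycle (edge_rel H) c -> odd (size c) -> (2 * n).+1 < size c.

Let target := n * (2 * k) + \sum_x (edge_degree H x - 2 * k).
Let F := [set M | matching H M && (#|M| == n.+1)].

Lemma ex_matching_card (H' : {set {set T}}) : n < nu H' ->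
  exists2 M, matching H' M & #|M| = n.+1.
Proof.
have [M /andP[/andP[sM tM] /eqP <-]] := ex_max_matching H'.
case/card_geqP => s [us ss sub]; exists [set e in s].
  have sub' : [set e in s] \subset M by apply/subsetP => e; rewrite inE => /sub.
  by rewrite /matching (subset_trans sub' sM) (trivIsetS sub' tM).
by rewrite cardsE (card_uniqP us).
Qed.

Definition selected (f : {set T} -> option bool) b := [set e in H | f e == Some b].

Lemma selected_matching f b : n < nu (selected f b) ->
  exists2 M, M \in F & forall e, e \in M -> f e = Some b.
Proof.
case/ex_matching_card => M mM cM; exists M.
  rewrite inE cM eqxx andbT; apply: matching_sub mM.
  by apply/subsetP=> e; rewrite inE => /andP[].
by move=> e eM; case/andP: mM => /subsetP/(_ e eM); rewrite inE => /andP[_ /eqP].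
Qed.

Lemma selected_card_le f b : nu (selected f b) <= n ->
  #|selected f b| <= n * k + \sum_x (edge_degree (selected f b) x - k).
Proof.
have sub : selected f b \subset H by apply/subsetP=> e; rewrite inE => /andP[].
move=> nuf; apply: sparse_edges => //; first by move=> e /(subsetP sub)/H2.
case: cover_cond => [|long]; [by left | right=> c /andP[cyc uc]].
apply: long; apply/andP; split=> //.
by apply: sub_cycle cyc => x y; apply: (subsetP sub).
Qed.

Lemma card_enum_count (P : pred {set T}) : #|[set e in H | P e]| = count P (enum H).
Proof.
rewrite -size_filter cardE; apply/perm_size/uniq_perm=> [||e].
- exact: enum_uniq.
- exact: filter_uniq (enum_uniq _).
by rewrite mem_enum inE [RHS]mem_filter mem_enum andbC.
Qed.

Lemma edge_degree_selected f b z : edge_degree (selected f b) z = vcount_sel f b z (enum H).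
Proof.
rewrite /vcount_sel -card_enum_count /edge_degree; apply: eq_card => e; rewrite !inE.
by rewrite -andbA; congr (_ && _); rewrite andbC.
Qed.

Lemma edge_degree_count z : edge_degree H z = vcount z (enum H).
Proof. by rewrite /vcount -card_enum_count. Qed.

Lemma card_selected f b E : perm_eq E (enum H) ->
  #|selected f b| = occurrences b (pmap f E).
Proof.
move=> EH; rewrite /selected card_enum_count -(permP EH); elim: E {EH} => //= e E ->.
by rewrite /occurrences; case: (f e).
Qed.

Variables (C : nat) (c : {set {set T}} -> nat).
Hypothesis c_bound : forall M, M \in F -> 0 < c M <= C.
Hypothesis c_proper : forall M N, M \in F -> N \in F -> [disjoint M & N] -> c M != c N.

Lemma walk_degree f b z x p :
    {subset walk_edges x p <= H} -> nonconsecutive f b (walk_edges x p) ->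
  2 * vcount_sel f b z (walk_edges x p) <=
  vcount z (walk_edges x p) + (x == z) + (last x p == z).
Proof.
case: p => [|y p] sub nc; first by rewrite /vcount_sel /=.
have := walk_vcount_sel z (fun e el => H2 (sub e el)) nc.
do 2 case: (_ == Some b); rewrite ?andbT /=; lia.
Qed.

Lemma all_edges_degree f b z ts : {subset all_edges ts <= H} ->
    nonconsecutive f b (all_edges ts) ->
  2 * vcount_sel f b z (all_edges ts) <= vcount z (all_edges ts) + count_mem z (trail_ends ts).
Proof.
elim: ts => // -[x p] ts IHts sub.
rewrite /nonconsecutive [all_edges _]/= => nc.
have nc1 : nonconsecutive f b (walk_edges x p) by have := cat_sorted2 nc => -[].
have nc2 : nonconsecutive f b (all_edges ts) by have := cat_sorted2 nc => -[].
have sub1 : {subset walk_edges x p <= H} by move=> e el; apply: sub; rewrite mem_cat el.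
have sub2 : {subset all_edges ts <= H} by move=> e el; apply: sub; rewrite mem_cat el orbT.
have := IHts sub2 nc2; have := walk_degree z sub1 nc1.
rewrite /vcount_sel /vcount /all_edges /trail_ends /= !count_cat /trail_edges /trail_end /=; lia.
Qed.

(** Every vertex z is an end of at most one trail, so each sign class R has
    2 deg_R z <= deg z + 1.  Together with the bound deg z for both classes, this
    gives an excess over k, summed over the signs, of at most the excess of deg z
    over 2k, and the two instances of [sparse_edges] add up to the target. *)
Lemma bound_of_open_trails ts : decomposition H ts -> uniq (trail_ends ts) ->
  #|H| <= target + C.
Proof.
move=> dec uends; pose E := all_edges ts.
have uE : uniq E by rewrite (perm_uniq dec) enum_uniq.
have -> : #|H| = size E by rewrite (perm_size dec) cardE.
rewrite -[_ + C]subn0; apply: (alternation_bound (F := F) (c := c)) => //.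
- by move=> A /c_bound/andP[].
move=> g long; have [f [fg alt_f size_f]] := alternating_selection g uE.
have deg_f b z : 2 * edge_degree (selected f b) z <= (edge_degree H z).+1.
  rewrite edge_degree_selected edge_degree_count /vcount_sel /vcount -!(permP dec).
  have := @all_edges_degree f b z ts _ (alternating_nonconsecutive b alt_f).
  have := count_uniq_mem z uends.
  rewrite /vcount_sel /vcount => -> leq2; apply: leq_trans (leq2 _) _.
    by move=> e; rewrite (perm_mem dec) mem_enum.
  by case: (_ \in _); rewrite ?addn1 ?addn0.
have deg_sum z : edge_degree (selected f true) z + edge_degree (selected f false) z <= edge_degree H z.
  rewrite !edge_degree_selected edge_degree_count /vcount_sel /vcount; elim: (enum H) => //= e l.
  by case: (z \in e) => /=; case: (f e) => [[]|] /=; lia.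
have [b nub] : exists b, n < nu (selected f b).
  have [|short_t] := ltnP n (nu (selected f true)); first by exists true.
  have [|short_f] := ltnP n (nu (selected f false)); first by exists false.
  have := selected_card_le short_t; have := selected_card_le short_f.
  rewrite !(card_selected _ _ dec) => le_f le_t.
  have size_E : size (pmap f E) = occurrences true (pmap f E) + occurrences false (pmap f E).
    by rewrite /occurrences; elim: (pmap f E) => //= -[] l ->; lia.
  suff : size (pmap f E) <= target by rewrite size_f leqNgt long.
  rewrite size_E /target; apply: leq_trans (leq_add le_t le_f) _.
  rewrite addnACA -big_split /= -mulnDr addnn -mul2n leq_add2l.
  apply: leq_sum => z _; have := deg_sum z; have := deg_f true z; have := deg_f false z; lia.
have [M MF monoM] := selected_matching nub.
exists M, b; split=> //; first by case/andP: (c_bound MF).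
by move=> e /monoM/fg.
Qed.

(** It suffices that in an alternating signing with at least target + 2 edges both
    signs contain an (n + 1)-matching, since two disjoint matchings have different
    colours and one of them has a colour larger than 1.  Suppose that the class R of
    sign b has none.  If the first and the last edge of the trail are both in R, the
    base point adds at most one to |R|, but R then has one edge more than the other
    class; otherwise 2 |R| <= target and the other class has at most |R| + 1 edges. *)
Lemma bound_of_closed_trail t : decomposition H [:: t] -> trail_end t = t.1 ->
  #|H| <= target + C.
Proof.
case: t => x p dec closed_t; rewrite /trail_end /= in closed_t.
(* Without any (n + 1)-matching there may be no colour, and no unit to gain. *)
have [nuH|] := leqP (nu H) n.
  apply: leq_trans (leq_addr _ _); apply: sparse_edges => //.
  by case: cover_cond => [le|]; [left; lia | right].
case/ex_matching_card => M0 mM0 cM0.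
have M0F : M0 \in F by rewrite inE mM0 cM0 /=.
have C_gt0 : 0 < C by have /andP[] := c_bound M0F; apply: leq_trans.
pose E := walk_edges x p.
have {}dec : perm_eq E (enum H) by move: dec; rewrite /decomposition /all_edges /= cats0.
have uE : uniq E by rewrite (perm_uniq dec) enum_uniq.
have -> : #|H| = size E by rewrite (perm_size dec) cardE.
have -> : target + C = target.+1 + C - 1 by lia.
have subE : {subset E <= H} by move=> e; rewrite (perm_mem dec) mem_enum.
apply: (alternation_bound (F := F) (c := c)) => //.
- by move=> A /c_bound/andP[].
move=> g long; have [f [fg alt_f size_f]] := alternating_selection g uE.
have nu_f b : n < nu (selected f b).
  rewrite ltnNge; apply/negP => short; have le_sel := selected_card_le short.
  have degE z : edge_degree (selected f b) z = vcount_sel f b z E /\ edge_degree H z = vcount z E.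
    by rewrite edge_degree_selected edge_degree_count /vcount_sel /vcount -!(permP dec).
  have nc := alternating_nonconsecutive b alt_f.
  have deg2 z : 2 * edge_degree (selected f b) z <= edge_degree H z + 2 * (x == z).
    have := walk_degree z subE nc; have [-> ->] := degE z; rewrite closed_t -/E; lia.
  have twice (u : T -> nat) :
      (forall z, 2 * edge_degree (selected f b) z <= edge_degree H z + 2 * u z) ->
      2 * occurrences b (pmap f E) <= target + 2 * \sum_z u z.
    move=> le_u; rewrite -(card_selected _ _ dec).
    have : 2 * #|selected f b| <= 2 * (n * k + \sum_z (edge_degree (selected f b) z - k)).
      by rewrite leq_mul2l le_sel.
    move/leq_trans; apply; rewrite mulnDr mulnCA /target -addnA leq_add2l.
    rewrite !big_distrr /= -big_split /=; apply: leq_sum => z _.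
    have := le_u z; lia.
  have {}long : target.+1 < runs (@pmap {set T} bool g E) := long.
  have E_neq : E <> [::] by move=> E0; rewrite E0 in long.
  have [y [q pE]] : exists y q, p = y :: q.
    by move: E_neq; rewrite /E; case: (p) => // y q _; exists y, q.
  have EE : E = walk_edges x (y :: q) by rewrite /E pE.
  have [a [l alE]] : exists a l, pmap f E = a :: l.
    by case: (pmap f E) size_f => [|a l _]; [move: long; case: runs | exists a, l].
  have cnt : runs (@pmap {set T} bool g E) + (a == b) + (last a l == b) =
      (2 * occurrences b (@pmap {set T} bool f E)).+1.
    by rewrite -size_f alE; apply: alternating_count; move: alt_f; rewrite alE.
  have [/andP[first_b last_b]|not_both] :=
      boolP ((f [set x; y] == Some b) && (f (last set0 E) == Some b)).
    have ab : a = b.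
      by move: alE; rewrite EE /= (eqP first_b) /= => -[].
    have lb : last a l = b.
      by rewrite -(last_pmap (l := E) a (eqP last_b)) ?EE // -EE alE.
    have := twice (fun z => (x == z)) deg2.
    rewrite (bigD1 x) //= eqxx big1 => [|z]; last by rewrite eq_sym => /negPf->.
    by move: cnt long; rewrite lb ab eqxx; clear; lia.
  have /twice : forall z, 2 * edge_degree (selected f b) z <= edge_degree H z + 2 * 0.
    move=> z; have [-> ->] := degE z.
    have := @walk_vcount_sel _ f b z x y q; rewrite -EE => /(_ _ nc)/wrap[].
      by move=> e /subE/H2.
    have -> : last y q = x by move: closed_t; rewrite pE.
    by move: not_both; do 2 case: (_ == Some b) => //=; rewrite ?andbT ?andbF; clear; lia.
  rewrite big1 // => le_cnt.
  have {}le_cnt : 2 * occurrences b (@pmap {set T} bool f E) <= target + 2 * 0 := le_cnt.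
  by move: cnt long le_cnt; case: (a == b); case: (last a l == b); clear; lia.
have [M1 M1F mono1] := selected_matching (nu_f true).
have [M2 M2F mono2] := selected_matching (nu_f false).
have : c M1 != c M2.
  apply: c_proper => //; rewrite -setI_eq0; apply/eqP/setP => e; rewrite !inE.
  by apply/negP=> /andP[/mono1 + /mono2] => ->.
have /andP[c1 _] := c_bound M1F; have /andP[c2 _] := c_bound M2F.
have [lt1 _|le1 neq] := ltnP 1 (c M1).
  by exists M1, true; split=> // e /mono1/fg.
exists M2, false; split=> //; first by move/eqP: neq; lia.
by move=> e /mono2/fg.
Qed.

Lemma matching_coloring_bound : #|H| <= target + C.
Proof.
have [ts dec [uends|[t ts_t closed_t]]] := good_decomposition H2 conn.
  exact: bound_of_open_trails dec uends.
by apply: bound_of_closed_trail closed_t; rewrite -ts_t.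
Qed.

End LowerBound.

(** * Simple graphs and their matching Kneser graphs *)

Section SimpleGraphs.
Variable G : sgraph.

Lemma edge_rel_adj : edge_rel (edges G) =2 @adj G.
Proof.
move=> x y; apply/imsetP/idP => [[[u w] uw eq_e]|xy]; last by exists (x, y); rewrite ?inE.
rewrite inE /= in uw.
have neq : u != w by apply: contraTneq uw => ->; rewrite adj_irrefl.
have : (x \in [set u; w]) && (y \in [set u; w]) by rewrite -eq_e !inE !eqxx orbT.
have : x != y.
  have : #|[set x; y]| = 2 by rewrite eq_e cards2 neq.
  by rewrite cards2; case: eqP.
rewrite !inE => xy /andP[/orP[]/eqP xE /orP[]/eqP yE]; move: xy; rewrite xE yE ?eqxx //.
by rewrite adj_sym.
Qed.

Lemma edges_two_sets : two_sets (edges G).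
Proof.
move=> _ /imsetP[[u w] uw ->]; rewrite inE /= in uw.
by rewrite cards2 /=; case: eqP uw => // ->; rewrite adj_irrefl.
Qed.

Lemma edge_degree_edges x : edge_degree (edges G) x = deg x.
Proof.
rewrite /deg -(card_in_imset (f := fun y => [set x; y])); last first.
  move=> y z; rewrite !inE => xy xz /setP/(_ y); rewrite !inE eqxx orbT.
  by move=> /esym/orP[/eqP yx|/eqP//]; rewrite yx adj_irrefl in xy.
apply: eq_card => e; rewrite inE; apply/andP/imsetP => [[eE xe]|[y]].
  have [y [xy eE']] := two_set_other edges_two_sets eE xe.
  by exists y; rewrite // inE -edge_rel_adj /edge_rel -eE'.
by rewrite inE => xy ->; rewrite -/(edge_rel _ x y) edge_rel_adj !inE eqxx.
Qed.

Lemma odd_cycle_girth g c : odd_girth_ge G g ->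
  ucycle (edge_rel (edges G)) c -> odd (size c) -> g <= size c.
Proof.
move=> girth /andP[cyc uc] oddc.
have {}cyc : cycle (@adj G) c by rewrite -(eq_cycle edge_rel_adj).
have c3 : 2 < size c.
  by case: c cyc oddc {uc} => [|x [|y [|z c]]] //=; rewrite adj_irrefl.
have hc : has_cycle G (size c).
  by rewrite /has_cycle c3 /=; apply/existsP; exists (in_tuple c); rewrite /ucycleb cyc.
move: girth; rewrite /odd_girth_ge /odd_girth.
have : size c \in [seq k <- iota 0 #|G|.+1 | odd k && has_cycle G k].
  by rewrite mem_filter oddc hc mem_iota ltnS /= -(card_uniqP uc) max_card.
have : sorted leq [seq k <- iota 0 #|G|.+1 | odd k && has_cycle G k].
  by rewrite sorted_filter //; [apply: leq_trans | apply: iota_sorted].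
case: (filter _ _) => //= k l sl; rewrite inE => /predU1P[->//|cl] gk.
by apply: leq_trans gk _; have /allP := order_path_min leq_trans sl; apply.
Qed.

(** Colours are shifted to start at 1, as [alternation_bound] uses 0 for the absence
    of a matching of constant sign. *)
Lemma proper_coloring_KG r C : 0 < r -> colorable (KG G r) C ->
  exists c : {set {set G}} -> nat,
    (forall M, is_rmatching r M -> 0 < c M <= C) /\
    (forall M N, is_rmatching r M -> is_rmatching r N -> [disjoint M & N] -> c M != c N).
Proof.
move=> r_gt0 /existsP[f /forallP proper_f].
exists (fun M => oapp (fun u : KG G r => (f u).+1) 0 (insub M)); split=> [M mM|M N mM mN disMN].
  by rewrite insubT /= ltn_ord.
rewrite !insubT /= eqSS; have /forallP/(_ (Sub N mN))/implyP := proper_f (Sub M mM).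
apply=> /=; rewrite /kg_adj /= disMN andbT -val_eqE /=.
apply: contraTneq disMN => ->; rewrite -setI_eq0 setIid -cards_eq0.
by case/and3P: mN => _ /eqP-> _; rewrite -lt0n.
Qed.

(** An r-matching has more edges than S has vertices, and its edges are disjoint, so
    one of them avoids S. *)
Lemma KG_colorable r (S : {set G}) : #|S| < r ->
  colorable (KG G r) #|[set e in edges G | [disjoint e & S]]|.
Proof.
move=> ltS; set U := [set e in _ | _].
have exU (u : KG G r) : exists e, (e \in val u) && (e \in U).
  move: (val u) (valP u) => M /and3P[sM /eqP cM tM].
  apply/existsP; apply: contraLR ltS; rewrite negb_exists -leqNgt -cM => /forallP noU.
  apply: leq_trans (_ : \sum_(e in M) \sum_(x in e) (x \in S) <= _).
    rewrite -sum1_card; apply: leq_sum => e eM.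
    have := noU e; rewrite eM inE (subsetP sM e eM) /= -setI_eq0 => /set0Pn[x].
    by rewrite inE => /andP[xe xS]; rewrite (bigD1 x) //= xS.
  rewrite -(big_trivIset _ tM) /= -big_mkcondr -[leqRHS]sum1_card.
  rewrite [leqRHS](bigID (mem (cover M))) /=.
  apply: leq_trans (leq_addr _ _); rewrite leq_eqVlt; apply/orP; left.
  by apply/eqP/eq_bigl => x; rewrite andbC.
pose e0 u := xchoose (exU u).
have e0P u : (e0 u \in val u) && (e0 u \in U) := xchooseP (exU u).
have e0U u : e0 u \in U by case/andP: (e0P u).
apply/existsP; exists [ffun u => enum_rank_in (e0U u) (e0 u)].
apply/forallP => u; apply/forallP => w; apply/implyP => /andP[_ dis]; rewrite !ffunE.
apply: contraTneq dis => /(congr1 enum_val); rewrite !enum_rankK_in // => eq_e.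
have /andP[eu _] := e0P u; have /andP[ew _] := e0P w.
by rewrite -setI_eq0; apply/set0Pn; exists (e0 u); rewrite inE eu eq_e.
Qed.

Lemma independent_edges (S : {set G}) : {in S &, forall x y, ~~ adj x y} ->
  #|[set e in edges G | [disjoint e & S]]| + \sum_(x in S) deg x <= #|edges G|.
Proof.
move=> indep; set U := [set e in _ | _].
have sU : U \subset edges G by apply/subsetP => e; rewrite inE => /andP[].
have := cardsID U (edges G); have /setIidPr-> := sU => <-; rewrite leq_add2l.
rewrite (eq_bigr (fun x => \sum_(e in edges G) if x \in e then 1 else 0)); last first.
  move=> x _; rewrite -edge_degree_edges -big_mkcondr /edge_degree -sum1_card.
  by apply: eq_bigl => e; rewrite inE.
rewrite exchange_big /= (big_setID U) /= big1 ?add0n => [|e].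
  rewrite -sum1_card; apply: leq_sum => e /setDP[eE eU].
  have -> : \sum_(x in S) (if x \in e then 1 else 0) = #|S :&: e|.
    by rewrite -big_mkcondr -sum1_card; apply: eq_bigl => x; rewrite inE.
  apply/card_le1_eqP => u w; rewrite !inE => /andP[uS ue] /andP[wS we].
  have [y [uy eE']] := two_set_other edges_two_sets eE ue.
  have uy_adj : adj u y by rewrite -edge_rel_adj /edge_rel -eE'.
  move: we; rewrite eE' !inE => /orP[/eqP//|/eqP wy].
  by have := indep _ _ uS wS; rewrite wy uy_adj.
rewrite inE => /andP[_]; rewrite inE => /andP[_ dis].
apply: big1 => x xS; case: ifP => // xe.
by move/disjoint_setI0/setP/(_ x): dis; rewrite !inE xe xS.
Qed.

Lemma connected_edge_rel : connected G -> forall x y, connect (edge_rel (edges G)) x y.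
Proof. by case=> _ conn x y; rewrite (eq_connect edge_rel_adj). Qed.

End SimpleGraphs.

(* The vertices are v 1, ..., v n; values of v outside 1..n are irrelevant. *)
Theorem theorem1 (r g n : nat) (G : sgraph) (v : nat -> G)
  (r_ge2 : 2 <= r)
  (G_conn : connected G)
  (G_girth : odd_girth_ge G g)
  (v_inj : forall i j : nat, 1 <= i <= n -> 1 <= j <= n -> v i = v j -> i = j)
  (v_surj : forall x : G, exists2 i : nat, 1 <= i <= n & v i = x)
  (v_deg : forall i j : nat, 1 <= i -> i <= j -> j <= n ->
             deg (v j) <= deg (v i))
  (r_le_n : r - 1 <= n)
  (r_bound : (r%:R <= Num.max (g%:R / 2%:R)
                              (((deg (v (r - 1)%N))%:R + 1) / 4%:R) :> rat)%R)
  (v_indep : forall i j : nat, 1 <= i <= r - 1 -> 1 <= j <= r - 1 ->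
               ~~ adj (v i) (v j))
  (deg_cond : ~~ odd (deg (v (r - 1))) \/
              (r <= n /\ deg (v r) < deg (v (r - 1)))) :
  ((chromatic_number (KG G r))%:Z =
     #|edges G|%:Z - \sum_(1 <= i < r) (deg (v i))%:Z)%R.
Proof.
have r_bound_nat : 2 * r <= g \/ 4 * r <= deg (v (r - 1)) + 1.
  move: r_bound; rewrite Order.TotalTheory.le_max => /orP[].
    rewrite Num.Theory.ler_pdivlMr ?Num.Theory.ltr0n // -GRing.natrM Num.Theory.ler_nat mulnC.
    by left.
  rewrite Num.Theory.ler_pdivlMr ?Num.Theory.ltr0n // GRing.natr1 -GRing.natrM.
  by rewrite Num.Theory.ler_nat => le_r; right; lia.
(* Whether D is even or not, 2 * k separates the degrees of v 1, ..., v (r - 1)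
   from the others. *)
pose D := deg (v (r - 1)); pose k := D./2.
have le_top i : 1 <= i < r -> 2 * k <= deg (v i).
  by move=> ir; have : D <= deg (v i) by [apply: v_deg; lia]; rewrite /k; lia.
have le_rest i : r <= i <= n -> deg (v i) <= 2 * k.
  move=> /andP[ri i_n]; case: deg_cond => [evenD|[rn ltr]].
    have : deg (v i) <= D by apply: v_deg; lia.
    by rewrite /k; lia.
  have : deg (v i) <= deg (v r) by apply: v_deg; lia.
  by rewrite /k; lia.
pose top := [seq v i | i <- index_iota 1 r].
have utop : uniq top.
  rewrite map_inj_in_uniq ?iota_uniq // => i j; rewrite !mem_index_iota => ir jr.
  by apply: v_inj; lia.
pose S := [set x in top].
have sumS F : \sum_(x in S) F x = \sum_(1 <= i < r) F (v i).
  rewrite (eq_bigl [in top]) => [|x]; last by rewrite inE.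
  by rewrite -big_uniq // big_map.
have cardS : #|S| = r - 1 by rewrite cardsE (card_uniqP utop) size_map size_iota.
have t_eq : (r - 1) * (2 * k) + \sum_x (edge_degree (edges G) x - 2 * k) =
    \sum_(1 <= i < r) deg (v i).
  rewrite (bigID (mem S)) /= [X in _ + (_ + X)]big1 => [|x].
    rewrite addn0 sumS -sum_nat_const_nat -big_split /=.
    by rewrite !big_nat; apply: eq_bigr => i ir; rewrite edge_degree_edges subnKC // le_top.
  have [i i_n <-] := v_surj x; rewrite inE => iN; apply/eqP; rewrite subn_eq0 edge_degree_edges.
  apply: le_rest; case/andP: i_n => i1 ->; rewrite andbT leqNgt; apply: contra iN => ir.
  by apply/mapP; exists i; rewrite // mem_index_iota i1.
have cond : (2 * (r - 1)).+1 <= k \/ forall c, ucycle (edge_rel (edges G)) c ->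
    odd (size c) -> (2 * (r - 1)).+1 < size c.
  case: r_bound_nat => [le_g|le_D]; [right|left].
    by move=> c uc oc; have := odd_cycle_girth G_girth uc oc; lia.
  by rewrite /k /D; lia.
rewrite /chromatic_number; case: ex_minnP => C colC minC.
have upper : C + \sum_(1 <= i < r) deg (v i) <= #|edges G|.
  rewrite -sumS; apply: leq_trans (independent_edges (S := S) _); last first.
    move=> x y; rewrite !inE => /mapP[i + ->] /mapP[j + ->]; rewrite !mem_index_iota => ir jr.
    by apply: v_indep; lia.
  by rewrite leq_add2r minC // KG_colorable // cardS; lia.
have lower : #|edges G| <= \sum_(1 <= i < r) deg (v i) + C.
  have r_gt0 : 0 < r by lia.
  have [c [c_bound c_proper]] := proper_coloring_KG r_gt0 colC.
  have inF M : M \in [set M | matching (edges G) M && (#|M| == (r - 1).+1)] -> is_rmatching r M.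
    rewrite inE => /andP[/andP[sM tM] /eqP cM].
    by rewrite /is_rmatching sM tM cM andbT /=; lia.
  rewrite -t_eq; apply: (matching_coloring_bound (@edges_two_sets G)
    (connected_edge_rel G_conn) cond (C := C) (c := c)).
  - by move=> M /inF/c_bound.
  by move=> M N /inF MF /inF NF; apply: c_proper.
have -> : (\sum_(1 <= i < r) (deg (v i))%:Z)%R = Posz (\sum_(1 <= i < r) deg (v i)).
  by rewrite (big_morph Posz PoszD (erefl _)).
lia.
Qed.
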